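(* Let $E, F, G$ be Fréchet spaces, where $F$ has property $(y)$ and where $G$ is not isomorphic to $\omega \times X$ for any Banach space $X$. Assume that there is a continuous, linear, unbounded operator $T : E \to F$ which factors through $G$ as $T = RS$, where $S : E \to G$ and $R : G \to F$ are continuous linear operators. Then there exists an infinite dimensional nuclear Köthe subspace $M$ of $E$ such that the restriction $T|_M : M \to T(M)$ and the restriction $R|_{S(M)} : S(M) \to R(S(M))$ are isomorphisms.
   Context: A continuous linear map $T : X \to Y$ between locally convex spaces is called bounded if there is a neighborhood $U$ of zero in $X$ such that $T(U)$ is bounded in $Y$; otherwise it is called unbounded. For a locally convex space $E$ with a base $\mathscr{U}(E)$ of neighborhoods of zero, $E'$ denotes the topological dual, $U^\circ \subset E'$ denotes the polar of $U$, and $E'[U^\circ]$ denotes the linear span of $U^\circ$ in $E'$, i.e. $E'[U^\circ] = \bigcup_{n \in \mathbb{N}} n U^\circ$. The space $E$ is said to have property $(y)$ if there is a neighborhood $U_1 \in \mathscr{U}(E)$ such that $$E' = \bigcup_{U \in \mathscr{U}(E)} \overline{E'[U_1^\circ] \cap U^\circ},$$ where the closure is taken in the weak-star topology $\sigma(E',E)$. $\omega = \mathbb{K}^{\mathbb{N}}$ ($\mathbb{K}$ the scalar field, $\mathbb{R}$ or $\mathbb{C}$) is the space of all scalar sequences with the product topology. A Köthe matrix is a matrix $A = (a_{n,k})_{n,k \in \mathbb{N}}$ of real numbers with $0 \le a_{n,k} \le a_{n,k+1}$ for all $n,k$ and such that for each $n$ there is $k$ with $a_{n,k} > 0$. The associated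 Köthe space is the Fréchet space $\lambda(A) = \{x = (x_n) \in \mathbb{K}^{\mathbb{N}} : \|x\|_k = \sum_n |x_n| a_{n,k} < \infty \text{ for all } k\}$ with the topology given by the seminorms $\|\cdot\|_k$. A nuclear Köthe subspace of $E$ is a closed linear subspace of $E$ which, with the subspace topology, is isomorphic to a nuclear Köthe space. ''Isomorphism'' means linear homeomorphism; the subspaces $M \subset E$, $T(M) = R(S(M)) \subset F$ and $S(M) \subset G$ carry the subspace topologies. *)

(* Defs.v *)
From HB Require Import structures.
From mathcomp Require Import all_boot all_order all_algebra.
From mathcomp Require Import all_classical all_reals all_analysis.
From mathcomp Require Import complex.

Set Implicit Arguments.
Unset Strict Implicit.
Unset Printing Implicit Defensive.

Import Order.TTheory GRing.Theory Num.Theory.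
Import numFieldNormedType.Exports.

Local Open Scope classical_set_scope.
Local Open Scope ring_scope.

Variant scalar_kind := RealScalars | ComplexScalars.

Definition scalar_field (R : realType) (s : scalar_kind) : numFieldType :=
  match s with RealScalars => R | ComplexScalars => complex R end.

(* `|x| lives in the scalar field itself; modulus is the same number in R. *)
Definition modulus (R : realType) (s : scalar_kind) : scalar_field R s -> R :=
  match s with
  | RealScalars => fun x => `|x|
  | ComplexScalars => fun x => complex.Re `|x|
  end.

Section modulus_theory.
Context (R : realType).

Lemma modulusC (x : complex R) :
  ((modulus (x : scalar_field R ComplexScalars))%:C)%C = `|x|.
Proof. by rewrite /modulus normc_def. Qed.

Context (s : scalar_kind).
Implicit Types x y : scalar_field R s.

Lemma modulus0 : modulus (0 : scalar_field R s) = 0.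
Proof.
case: s => /=; first exact: normr0.
exact: (congr1 (@complex.Re R) (@normr0 _ (complex R))).
Qed.

Lemma modulus_ge0 x : 0 <= modulus x.
Proof.
case: s x => x; first exact: normr_ge0.
by rewrite -lecR modulusC; exact: normr_ge0.
Qed.

Lemma modulusM x y : modulus (x * y) = modulus x * modulus y.
Proof.
case: s x y => x y; first exact: normrM.
by apply: complexI; rewrite rmorphM /= !modulusC; exact: normrM.
Qed.

Lemma modulusD x y : modulus (x + y) <= modulus x + modulus y.
Proof.
case: s x y => x y; first exact: ler_normD.
by rewrite -lecR rmorphD /= !modulusC; exact: ler_normD.
Qed.

Lemma modulusN1 : modulus (-1 : scalar_field R s) = 1.
Proof.
case: s => /=; first exact: normrN1.
exact: (congr1 (@complex.Re R) (normrN1 (complex R))).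
Qed.

Lemma modulus_conv x : 0 <= x -> x <= 1 -> modulus x + modulus (1 - x) = 1.
Proof.
move=> x0; rewrite -subr_ge0; case: s x x0 => x x0 x1.
  by rewrite /modulus (ger0_norm x0) (ger0_norm x1) addrC subrK.
apply: complexI; rewrite rmorphD rmorph1 /= !modulusC.
by rewrite (ger0_norm x0) (ger0_norm x1) addrC subrK.
Qed.

Lemma nbhs_modulus x (e : R) : 0 < e ->
  nbhs (x : (scalar_field R s)^o) [set y | modulus (y - x) < e].
Proof.
move=> e0; case: s x => x.
  apply/nbhs_ballP; exists e => //= y; rewrite -ball_normE /=.
  by rewrite distrC.
apply/nbhs_ballP; exists (e%:C)%C; first by rewrite /= ltcR.
by move=> y; rewrite -ball_normE /= distrC -(modulusC (y - x)) ltcR.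
Qed.

End modulus_theory.

Lemma conv_lmodE (K : numDomainType) (E : lmodType K) (l : {i01 K})
    (x y : convex_lmodType E) :
  conv l x y = (l%:inum : K) *: (x : E) + (1 - l%:inum : K) *: (y : E) :> E.
Proof. by []. Qed.

Lemma convex_comb_lt (R : numFieldType) (a b u v e : R) :
  0 <= a -> 0 <= b -> a + b = 1 -> u < e -> v < e -> a * u + b * v < e.
Proof.
move=> a0 b0 ab1 ue ve; rewrite -[ltRHS]mul1r -ab1 mulrDl.
have [a00|an0] := eqVneq a 0.
  by move: ab1; rewrite a00 add0r => ->; rewrite !mul0r !add0r !mul1r.
apply: ltr_leD; last by rewrite ler_wpM2l// ltW.
by rewrite ltr_pM2l// lt_neqAle eq_sym an0.
Qed.

Definition omega (K : numFieldType) : Type := nat -> K^o.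

Section omega_tvs.
Context (K : numFieldType).
Local Notation omega := (omega K).

HB.instance Definition _ := GRing.Lmodule.copy omega (nat -> K^o).
HB.instance Definition _ := Topological.copy omega {ptws nat -> K^o}.

Lemma omega_cvgP (F : set_system omega) (x : omega) : Filter F ->
  (forall i, (fun y : omega => y i) @ F --> x i) -> F --> x.
Proof.
move=> FF Fx; apply/cvg_sup => i U [_ [[W oW <-] /= Wx]] WU.
by apply: filterS WU _; apply: (Fx i); exact: open_nbhs_nbhs.
Qed.

Lemma omega_proj_continuous i : continuous (fun y : omega => (y i : K^o)).
Proof. exact: (@proj_continuous nat (fun=> K^o) i). Qed.

Lemma omega_add_continuous : continuous (fun x : omega * omega => x.1 + x.2).
Proof.
move=> x; apply: omega_cvgP => i.
have x1 : (fun y : omega * omega => y.1 i : K^o) @ x --> (x.1 i : K^o).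
  exact: (@continuous_comp _ _ K^o fst (fun y : omega => y i) _ cvg_fst
    (@omega_proj_continuous i _)).
have x2 : (fun y : omega * omega => y.2 i : K^o) @ x --> (x.2 i : K^o).
  exact: (@continuous_comp _ _ K^o snd (fun y : omega => y i) _ cvg_snd
    (@omega_proj_continuous i _)).
exact: (cvgD x1 x2).
Qed.

Lemma omega_scale_continuous : continuous (fun z : K^o * omega => z.1 *: z.2).
Proof.
move=> z; apply: omega_cvgP => i.
have z1 : (fun y : K^o * omega => y.1) @ z --> z.1 by exact: cvg_fst.
have z2 : (fun y : K^o * omega => y.2 i : K^o) @ z --> (z.2 i : K^o).
  exact: (@continuous_comp _ _ K^o snd (fun y : omega => y i) _ cvg_snd
    (@omega_proj_continuous i _)).
exact: (cvgZ z1 z2).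
Qed.

Lemma omega_locally_convex : exists2 B : set_system omega,
  (forall b, b \in B -> convex_set b) & basis B.
Proof.
exists [set U : set omega | open U /\ convex_set U].
  by move=> U /[!inE] -[].
split=> [U []//|x].
have FF : Filter (filter_from
    [set U : set omega | ([set V : set omega | open V /\ convex_set V]) U /\ U x]
    id).
  apply: filter_from_filter.
    by exists setT; split=> //; split; [exact: openT|move=> *; exact: mem_set].
  move=> U V [[oU cU] Ux] [[oV cV] Vx]; exists (U `&` V) => //.
  split=> //; split; first exact: openI.
  move=> a b l; rewrite !in_setI => /andP[aU aV] /andP[bU bV].
  by rewrite cU// cV.
apply: omega_cvgP => i A /nbhs_ballP[e /= e0 eA].
exists [set y : omega | ball (x i : K^o) e (y i)]; last by move=> y; exact: eA.
split; last exact: ballxx.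
split.
  apply: (@open_comp _ _ (fun y : omega => (y i : K^o)) (ball (x i : K^o) e)).
    by move=> y _; exact: omega_proj_continuous.
  exact: ball_open.
move=> y z l; rewrite !inE -ball_normE /= => xy xz.
rewrite (_ : x i - _ = (l%:inum : K) * (x i - y i)
   + (1 - l%:inum : K) * (x i - z i)); last first.
  by rewrite !mulrBr opprD addrACA -mulrDl subrKC mul1r.
have l0 : 0 <= (l%:inum : K) by [].
have l1 : 0 <= (1 - l%:inum : K) by rewrite subr_ge0.
rewrite (le_lt_trans (ler_normD _ _))// !normrM (ger0_norm l0) (ger0_norm l1).
by apply: convex_comb_lt => //; rewrite subrKC.
Qed.

(* PreTopologicalLmod_isTvs only declares the uniform structure. *)
HB.instance Definition _ := @PreTopologicalLmod_isTvs.Build K omega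
  omega_add_continuous omega_scale_continuous omega_locally_convex.
HB.instance Definition _ :=
  PreTopologicalNmodule_isTopologicalNmodule.Build omega omega_add_continuous.
HB.instance Definition _ :=
  TopologicalNmodule_isTopologicalLmodule.Build K omega omega_scale_continuous.
HB.instance Definition _ := Uniform_isTvs.Build K omega omega_locally_convex.

End omega_tvs.

Record kothe_matrix (R : realType) := KotheMatrix {
  kothe_coef :> nat -> nat -> R;
  kothe_coef_ge0 : forall n k, 0 <= kothe_coef n k;
  kothe_coef_mono : forall n k, kothe_coef n k <= kothe_coef n k.+1;
  kothe_coef_pos : forall n, exists k, 0 < kothe_coef n k
}.

Section kothe_space.
Context (R : realType) (s : scalar_kind) (a : kothe_matrix R).
Local Notation K := (scalar_field R s).
Implicit Types x y : nat -> K^o.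

Definition kothe_norm (k : nat) x : \bar R :=
  (\sum_(n <oo) (modulus (x n) * a n k)%:E)%E.

Definition kothe_summable : {pred (nat -> K^o)} :=
  mem [set x | forall k, (kothe_norm k x < +oo)%E].

Let term_ge0 k x n : (0 <= (modulus (x n) * a n k)%:E)%E.
Proof. by rewrite lee_fin mulr_ge0 ?modulus_ge0// kothe_coef_ge0. Qed.

Lemma kothe_norm_ge0 k x : (0 <= kothe_norm k x)%E.
Proof. by apply: nneseries_ge0 => n _ _; exact: term_ge0. Qed.

Lemma kothe_norm0 k : kothe_norm k 0 = 0%E.
Proof.
by apply: eseries0 => n _ _; rewrite (_ : 0 n = 0)// modulus0 mul0r.
Qed.

Lemma kothe_normD k x y :
  (kothe_norm k (x + y)%R <= kothe_norm k x + kothe_norm k y)%E.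
Proof.
rewrite -nneseriesD; [|by move=> *; exact: term_ge0..].
apply: lee_nneseries => [n _ _|n _]; first exact: term_ge0.
rewrite -EFinD lee_fin -mulrDl ler_wpM2r ?kothe_coef_ge0//.
exact: modulusD.
Qed.

Lemma kothe_normZ k (c : K) x :
  kothe_norm k (c *: x) = ((modulus c)%:E * kothe_norm k x)%E.
Proof.
rewrite -nneseriesZl; last by move=> n _; exact: term_ge0.
by apply: eq_eseriesr => n _; rewrite -EFinM mulrA -modulusM.
Qed.

Lemma kothe_norm_mono k l x : (k <= l)%N -> (kothe_norm k x <= kothe_norm l x)%E.
Proof.
move=> kl; apply: lee_nneseries => [n _ _|n _]; first exact: term_ge0.
rewrite lee_fin ler_wpM2l ?modulus_ge0//.
by have /nondecreasing_seqP := kothe_coef_mono a n; apply.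
Qed.

Lemma kothe_submod_closed : submod_closed kothe_summable.
Proof.
split=> [|c x y]; rewrite !inE /=; first by move=> k; rewrite kothe_norm0.
move=> xf yf k; apply: le_lt_trans (kothe_normD _ _ _) _.
rewrite kothe_normZ lte_add_pinfty// lte_mul_pinfty//.
  by rewrite lee_fin modulus_ge0.
Qed.

HB.instance Definition _ :=
  GRing.isSubmodClosed.Build _ _ kothe_summable kothe_submod_closed.

Record kothe_space : Type := KotheSpace {
  kothe_seq :> nat -> K^o;
  kothe_seqP : kothe_seq \in kothe_summable
}.

HB.instance Definition _ := [isSub for kothe_seq].
HB.instance Definition _ := [Choice of kothe_space by <:].
HB.instance Definition _ := [SubChoice_isSubLmodule of kothe_space by <:].

(* ||x||_k on lambda(A), where it is finite. *)
Definition kothe_seminorm (k : nat) (x : kothe_space) : R :=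
  fine (kothe_norm k x).

End kothe_space.

Section kothe_tvs.
Context (R : realType) (s : scalar_kind) (a : kothe_matrix R).
Local Notation K := (scalar_field R s).
Local Notation V := (kothe_space s a).
Local Notation p := (@kothe_seminorm R s a).
Implicit Types x y z : V.

Lemma kothe_seminormE k x : (p k x)%:E = kothe_norm a k x.
Proof.
rewrite fineK// fin_numElt (lt_le_trans _ (kothe_norm_ge0 _ _ _)) ?ltNyr//=.
by have := kothe_seqP x; rewrite inE /=; exact.
Qed.

Lemma kothe_seminorm_ge0 k x : 0 <= p k x.
Proof. by rewrite fine_ge0// kothe_norm_ge0. Qed.

Lemma kothe_seminorm0 k : p k 0 = 0.
Proof. by rewrite /kothe_seminorm kothe_norm0. Qed.

Lemma kothe_seqD x y : kothe_seq (x + y) = kothe_seq x + kothe_seq y.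
Proof. by []. Qed.

Lemma kothe_seqZ (c : K) x : kothe_seq (c *: x) = c *: kothe_seq x.
Proof. by []. Qed.

Lemma kothe_seminormD k x y : p k (x + y) <= p k x + p k y.
Proof.
rewrite -lee_fin EFinD 3!kothe_seminormE kothe_seqD.
exact: kothe_normD.
Qed.

Lemma kothe_seminormZ k (c : K) x : p k (c *: x) = modulus c * p k x.
Proof.
apply: EFin_inj; rewrite EFinM 2!kothe_seminormE kothe_seqZ.
exact: kothe_normZ.
Qed.

Lemma kothe_seminormB k x y : p k (x - y) = p k (y - x).
Proof. by rewrite -opprB -scaleN1r kothe_seminormZ modulusN1 mul1r. Qed.

Lemma kothe_seminorm_mono k l x : (k <= l)%N -> p k x <= p l x.
Proof. by rewrite -lee_fin !kothe_seminormE; exact: kothe_norm_mono. Qed.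

(* Since ||.||_k is nondecreasing in k, the balls of the single seminorms form
   a base of the topology they generate. *)
Definition kothe_ball (x : V) (k : nat) (e : R) : set V :=
  [set y | p k (y - x) < e].

Definition kothe_nbhs (x : V) : set_system V :=
  [set A | exists k, exists2 e : R, 0 < e & kothe_ball x k e `<=` A].

Let kothe_nbhs_filter x : ProperFilter (kothe_nbhs x).
Proof.
split.
  by move=> [k [e e0 /(_ x)]]; apply; rewrite /kothe_ball/= subrr kothe_seminorm0.
split; first by exists 0%N, 1.
  move=> A B [k [e e0 eA]] [l [d d0 dB]].
  exists (maxn k l), (Num.min e d); first by rewrite lt_min e0.
  move=> y; rewrite /kothe_ball/= lt_min => /andP[ye yd]; split.
    apply: eA; apply: le_lt_trans ye; apply: kothe_seminorm_mono.
    exact: leq_maxl.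
  apply: dB; apply: le_lt_trans yd; apply: kothe_seminorm_mono.
  exact: leq_maxr.
by move=> A B AB [k [e e0 eA]]; exists k, e => //; exact: subset_trans AB.
Qed.

Let kothe_nbhs_singleton x A : kothe_nbhs x A -> A x.
Proof.
by move=> [k [e e0]]; apply; rewrite /kothe_ball/= subrr kothe_seminorm0.
Qed.

Let kothe_ball_nbhs x k e y : kothe_ball x k e y -> kothe_nbhs y (kothe_ball x k e).
Proof.
rewrite /kothe_ball/= => ye; exists k, (e - p k (y - x)); first by rewrite subr_gt0.
move=> z; rewrite /kothe_ball/= ltrBrDr; apply: le_lt_trans.
by rewrite -[z - x](subrKA y); exact: kothe_seminormD.
Qed.

Let kothe_nbhs_nbhs x A : kothe_nbhs x A -> kothe_nbhs x (kothe_nbhs^~ A).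
Proof.
move=> [k [e e0 eA]]; exists k, e => // y /kothe_ball_nbhs.
by move=> [l [d d0 dB]]; exists l, d => //; exact: subset_trans eA.
Qed.

HB.instance Definition _ := hasNbhs.Build V kothe_nbhs.
HB.instance Definition _ := Nbhs_isNbhsTopological.Build V
  kothe_nbhs_filter kothe_nbhs_singleton kothe_nbhs_nbhs.

Lemma kothe_ball_open x k e : open (kothe_ball x k e).
Proof. by rewrite openE => y /kothe_ball_nbhs. Qed.

Lemma kothe_add_continuous : continuous (fun x : V * V => x.1 + x.2).
Proof.
move=> [x y] A [k [e e0 eA]].
exists (kothe_ball x k (e / 2), kothe_ball y k (e / 2)) => /=.
  by split; exists k, (e / 2) => //; rewrite divr_gt0.
move=> [u v] /= [ux vy]; apply: eA; rewrite /kothe_ball/=.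
rewrite opprD addrACA (le_lt_trans (kothe_seminormD _ _ _))//.
by rewrite [ltRHS]splitr ltrD.
Qed.

Lemma kothe_scale_continuous : continuous (fun z : K^o * V => z.1 *: z.2).
Proof.
move=> [c x] A [k [e e0 eA]].
pose M := p k x + 1; pose d := Num.min 1 (e / 2 / (modulus c + 1)).
have M0 : 0 < M by rewrite ltr_wpDl// kothe_seminorm_ge0.
have c0 : 0 < modulus c + 1 by rewrite ltr_wpDl// modulus_ge0.
have d0 : 0 < d by rewrite lt_min ltr01 !divr_gt0.
exists ([set b : K^o | modulus (b - c) < e / 2 / M], kothe_ball x k d) => /=.
  split; first by apply: nbhs_modulus; rewrite !divr_gt0.
  by exists k, d.
move=> [b y] /= [bc yx]; apply: eA; rewrite /kothe_ball/=.
rewrite (_ : b *: y - c *: x = (b - c) *: y + c *: (y - x)); last first.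
  by rewrite scalerBl scalerBr addrA subrK.
rewrite (le_lt_trans (kothe_seminormD _ _ _))// !kothe_seminormZ.
rewrite [ltRHS]splitr ltr_leD//.
  apply: (@le_lt_trans _ _ (modulus (b - c) * M)); last by rewrite -ltr_pdivlMr.
  rewrite ler_wpM2l ?modulus_ge0// -[y](subrK x).
  rewrite (le_trans (kothe_seminormD _ _ _))// addrC lerD2l ltW//.
  by rewrite (lt_le_trans yx)// ge_min lexx.
apply: (@le_trans _ _ ((modulus c + 1) * d)).
  by rewrite ler_pM ?modulus_ge0 ?kothe_seminorm_ge0 ?lerDl// ltW.
by rewrite mulrC -ler_pdivlMr// ge_min lexx orbT.
Qed.

Lemma kothe_ball_convex x k e : convex_set (kothe_ball x k e).
Proof.
move=> y z l /set_mem yx /set_mem zx; apply/mem_set.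
have l0 : 0 <= (l%:inum : K) by [].
have l1 : (l%:inum : K) <= 1 by [].
have lx : (l%:inum : K) *: (y : V) + (1 - l%:inum : K) *: (z : V) - x =
          (l%:inum : K) *: ((y : V) - x) + (1 - l%:inum : K) *: ((z : V) - x).
  by rewrite !scalerBr addrACA -opprD -scalerDl subrKC scale1r.
rewrite /kothe_ball /mkset conv_lmodE lx (le_lt_trans (kothe_seminormD _ _ _))//.
rewrite 2!kothe_seminormZ; apply: convex_comb_lt yx zx.
- exact: modulus_ge0.
- exact: modulus_ge0.
- exact: modulus_conv.
Qed.

Lemma kothe_locally_convex : exists2 B : set_system V,
  (forall b, b \in B -> convex_set b) & basis B.
Proof.
exists [set U | exists x, exists k, exists e, U = kothe_ball x k e].
  by move=> U /set_mem [x [k [e ->]]]; exact: kothe_ball_convex.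
split=> [_ [x [k [e ->]]]|x A [k [e e0 eA]]]; first exact: kothe_ball_open.
exists (kothe_ball x k e) => //; split; first by exists x, k, e.
by rewrite /kothe_ball/= subrr kothe_seminorm0.
Qed.

HB.instance Definition _ := @PreTopologicalLmod_isTvs.Build K V
  kothe_add_continuous kothe_scale_continuous kothe_locally_convex.
HB.instance Definition _ :=
  PreTopologicalNmodule_isTopologicalNmodule.Build V kothe_add_continuous.
HB.instance Definition _ :=
  TopologicalNmodule_isTopologicalLmodule.Build K V kothe_scale_continuous.
HB.instance Definition _ := Uniform_isTvs.Build K V kothe_locally_convex.

End kothe_tvs.

Section locally_convex_notions.
Context (K : numFieldType).
Implicit Types E F : tvsType K.

Definition linear_subspace E (M : set E) : Prop :=
  M 0 /\ forall (c : K) x y, M x -> M y -> M (c *: x + y).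

Definition finite_dimensional E (M : set E) : Prop :=
  exists (n : nat) (v : 'I_n -> E), (forall i, M (v i)) /\
    forall x, M x -> exists c : 'I_n -> K, x = \sum_(i < n) c i *: v i.

(* The uniformity carried by a tvsType induces its topology but need not be
   the translation-invariant one, so completeness is phrased with
   neighborhoods of zero instead of completeType. *)
Definition tvs_cauchy E (Phi : set_system E) : Prop :=
  forall U : set E, nbhs 0 U ->
    exists2 A, Phi A & forall x y, A x -> A y -> U (x - y).

Definition tvs_complete E : Prop :=
  forall Phi : set_system E, ProperFilter Phi -> tvs_cauchy Phi ->
    exists x : E, Phi --> x.

(* A tvsType is locally convex by definition; a Hausdorff one is metrizable
   exactly when zero has a countable base of neighborhoods. *)
Definition frechet E : Prop :=
  [/\ hausdorff_space E,
      (exists U : nat -> set E, (forall n, nbhs 0 (U n)) /\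
         forall V : set E, nbhs 0 V -> exists n, U n `<=` V) &
      tvs_complete E].

Definition tvs_bounded E (B : set E) : Prop :=
  forall V : set E, nbhs 0 V ->
    exists2 r : K, 0 < r & B `<=` [set r *: v | v in V].

Definition bounded_operator E F (T : E -> F) : Prop :=
  exists2 U : set E, nbhs 0 U & tvs_bounded (T @` U).

(* f restricts to a linear homeomorphism from A to B, both with their subspace
   topologies; meant for linear subspaces A and B. *)
Definition isomorphism_on E F (A : set E) (B : set F) (f : E -> F) : Prop :=
  [/\ forall (c : K) x y, A x -> A y -> f (c *: x + y) = c *: f x + f y,
      set_bij A B f,
      {within A, continuous f} &
      exists g : F -> E,
        (forall x, A x -> g (f x) = x) /\ {within B, continuous g}].

Definition isomorphic E F : Prop :=
  exists f : E -> F, isomorphism_on setT setT f.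

Definition dual E : set (E -> K^o) := [set f | linear f /\ continuous f].

Definition polar E (U : set E) : set (E -> K^o) :=
  [set f | dual f /\ forall x, U x -> `|f x| <= 1].

Definition polar_span E (U : set E) : set (E -> K^o) :=
  \bigcup_(n : nat) [set (fun x => n%:R * f x) | f in polar U].

(* sigma(E', E) is the topology of pointwise convergence on E. *)
Definition weak_star_closure E (A : set (E -> K^o)) : set (E -> K^o) :=
  @dual E `&` closure (A : set {ptws E -> K^o}).

Definition property_y E : Prop :=
  exists2 U1 : set E, nbhs 0 U1 &
    @dual E = \bigcup_(U in nbhs (0 : E))
                weak_star_closure (polar_span U1 `&` polar U).

(* Seminorms take their values in the scalar field, like the norms of a
   normedModType; nonnegative scalars are real. *)
Definition continuous_seminorm E (p : E -> K^o) : Prop :=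
  [/\ forall x y, p (x + y) <= p x + p y,
      forall (c : K) x, p (c *: x) = `|c| * p x &
      continuous p].

(* (B, i) is a completion of the normed space E / ker p; such a pair exists
   and is unique up to a linear isometry compatible with i. *)
Definition local_banach E (p : E -> K^o) (B : completeNormedModType K)
    (i : {linear E -> B}) : Prop :=
  (forall x, `|i x| = p x) /\ dense (range i).

(* A = sum_j a_j(.) y_j with sum_j ||a_j|| ||y_j|| finite, where c_j bounds the
   operator norm ||a_j||. *)
Definition nuclear_operator (X Y : completeNormedModType K) (A : X -> Y) :
    Prop :=
  exists (a : nat -> X -> K^o) (c : nat -> K) (y : nat -> Y),
    [/\ forall j, dual (a j),
        forall j, 0 <= c j /\ forall x, `|a j x| <= c j * `|x|,
        cvgn (series (fun j => c j * `|y j| : K^o)) &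
        forall x, series (fun j => a j x *: y j) @ \oo --> A x].

(* For every continuous seminorm p there is a continuous seminorm q >= p such
   that the canonical map E_q -> E_p between the local Banach spaces is
   nuclear. *)
Definition nuclear_space E : Prop :=
  forall p : E -> K^o, continuous_seminorm p ->
  exists q : E -> K^o, [/\ continuous_seminorm q, forall x, p x <= q x &
    forall (Eq Ep : completeNormedModType K)
           (iq : {linear E -> Eq}) (ip : {linear E -> Ep}),
      local_banach q iq -> local_banach p ip ->
      exists A : {linear Eq -> Ep},
        nuclear_operator A /\ forall x, A (iq x) = ip x].

End locally_convex_notions.

Definition nuclear_kothe_subspace (R : realType) (s : scalar_kind)
    (E : tvsType (scalar_field R s)) (M : set E) : Prop :=
  [/\ linear_subspace M,
      closed M &
      exists a : kothe_matrix R,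
        nuclear_space (kothe_space s a : tvsType (scalar_field R s)) /\
        exists f : kothe_space s a -> E, isomorphism_on setT M f].

(* Main.v *)
Require Import Defs.
From HB Require Import structures.
From mathcomp Require Import all_boot all_order all_algebra.
From mathcomp Require Import all_classical all_reals all_analysis.
From mathcomp Require Import complex ring lra.

(* It suffices to treat T: once T is an isomorphism on M, the inverse of R on
   S(M) is S composed with the inverse of T|_M.

   Property (y) provides a fundamental system of seminorms q_0 <= q_1 <= ... on
   F, each q_m being a supremum of |f| over functionals f continuous for q_0
   (that these q_m detect unboundedness of T uses that weakly bounded sets are
   bounded).  After thinning, p_k is a fundamental system on E with
   q_k o T <= p_k, and q_{k+1} o T is not dominated by p_k.  Since q_0-continuous
   functionals pull back to p_0-continuous ones, this unboundedness persists on
   finite-codimensional kernels, so one can choose inductively x_i in E with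
   6^i p_k(x_i) <= q_{k+1}(T x_i) for k <= i, together with functionals
   f_{i,m} (m <= i) nearly norming T x_i for q_m and vanishing on all later
   T x_l.  Triangularity gives |c_i| q_m(T x_i) <= A_m 3^i q_m(T sum c_l x_l),
   and the factor 6^i beats 3^i: sum |c_i| p_k(x_i) <= B_k q_{k+1}(T sum c_i x_i).
   Hence M, the set of sums sum c_i x_i with c in the Koethe space of the matrix
   p_k(x_i), works; it is nuclear because p_k(x_i) <= 6^-i p_{k+1}(x_i). *)

Set Implicit Arguments.
Unset Strict Implicit.
Unset Printing Implicit Defensive.

Import Order.TTheory GRing.Theory Num.Theory.
Import numFieldNormedType.Exports.

Local Open Scope classical_set_scope.
Local Open Scope ring_scope.

(** * Real and complex scalars *)

(** Property (y) is what keeps all levels alive at once. A functional nearly norming T x_i for q_m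
    would in general be controlled only by q_m, and projecting along its kernel would say nothing
    about the levels k < m. The functionals used here lie in the span of the polar of one fixed
    neighborhood, so each is bounded by a multiple of q_0 and every cut is harmless at every level.
    The constants: the functionals norm only up to a factor 2, so solving the triangular system
    costs a factor 1 + 2 = 3 per index, and 6 = 2 * 3 leaves the summable factor 2^-i. The final
    estimates form a chain p_k(f c) <= ||c||_k <= r(T (f c)), where f c is the sum of the series
    with coefficients c and r is a continuous seminorm on F depending on k. The left half makes f
    continuous; the right half gives continuity of the inverses of f and of T on the image; both
    together with completeness of the Koethe space make the image closed. *)

Definition scal (R : realType) (s : scalar_kind) : R -> scalar_field R s :=
  match s with RealScalars => id | ComplexScalars => real_complex R end.
Arguments scal {R} s.

Section scalars.
Context (R : realType) (s : scalar_kind).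
Local Notation K := (scalar_field R s).
Local Notation sc := (@scal R s).

Lemma scalD a b : sc (a + b) = sc a + sc b.
Proof. by case: s => //=; exact: (rmorphD (real_complex R)). Qed.

Lemma scalM a b : sc (a * b) = sc a * sc b.
Proof. by case: s => //=; exact: (rmorphM (real_complex R)). Qed.

Lemma scal1 : sc 1 = 1.
Proof. by case: s. Qed.

Lemma scal0 : sc 0 = 0.
Proof. by case: s. Qed.

Lemma scalN a : sc (- a) = - sc a.
Proof. by case: s => //=; exact: (rmorphN (real_complex R)). Qed.

Lemma scalB a b : sc (a - b) = sc a - sc b.
Proof. by rewrite scalD scalN. Qed.

Lemma scal_le a b : (sc a <= sc b) = (a <= b).
Proof. by case: s => //=; exact: lecR. Qed.

Lemma scal_lt a b : (sc a < sc b) = (a < b).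
Proof. by case: s => //=; exact: ltcR. Qed.

Lemma scal_ge0 a : (0 <= sc a) = (0 <= a).
Proof. by rewrite -scal0 scal_le. Qed.

Lemma scal_gt0 a : (0 < sc a) = (0 < a).
Proof. by rewrite -scal0 scal_lt. Qed.

Lemma normE (x : K) : `|x| = sc (modulus x).
Proof. by case: s x => [|] x //; rewrite /= -modulusC. Qed.

Lemma modulus_scal a : modulus (sc a) = `|a|.
Proof.
by case: s => //; apply: complexI; rewrite modulusC normc_def/= expr0n addr0 sqrtr_sqr.
Qed.

Lemma ge0_scal (x : K) : 0 <= x -> x = sc (modulus x).
Proof. by move=> /ger0_norm <-; rewrite normE modulus_scal ger0_norm ?modulus_ge0. Qed.

Lemma modulus_eq0 (x : K) : modulus x = 0 -> x = 0.
Proof. by move=> x0; apply/eqP; rewrite -normr_eq0 normE x0 scal0. Qed.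

Lemma modulusN (x : K) : modulus (- x) = modulus x.
Proof. by rewrite -mulN1r modulusM modulusN1 mul1r. Qed.

Lemma modulusBC (x y : K) : modulus (x - y) = modulus (y - x).
Proof. by rewrite -modulusN opprB. Qed.

Lemma modulus1 : modulus (1 : K) = 1.
Proof. by rewrite -scal1 modulus_scal normr1. Qed.

Lemma modulusV (x : K) : modulus x^-1 = (modulus x)^-1.
Proof.
have [->|x0] := eqVneq x 0; first by rewrite invr0 modulus0 invr0.
have m0 : modulus x != 0 by apply: contra_neq x0; exact: modulus_eq0.
by apply: (mulIf m0); rewrite -modulusM !mulVf// modulus1.
Qed.

Lemma modulus_sum (I : Type) (r : seq I) (P : pred I) (F : I -> K) :
  modulus (\sum_(i <- r | P i) F i) <= \sum_(i <- r | P i) modulus (F i).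
Proof.
elim/big_ind2 : _ => //; first by rewrite modulus0.
by move=> a b c d ab cd; rewrite (le_trans (modulusD _ _))// lerD.
Qed.

Lemma nbhs_modulusP (x : K) (A : set K^o) : nbhs (x : K^o) A ->
  exists2 e : R, 0 < e & forall y, modulus (y - x) < e -> A y.
Proof.
move=> /nbhs_ballP[e /= e0 eA]; have eE := ge0_scal (ltW e0).
exists (modulus e); first by rewrite -scal_gt0 -eE.
by move=> y yx; apply: eA; rewrite -ball_normE /= distrC normE eE scal_lt.
Qed.

Definition real_part : K -> R :=
  match s with RealScalars => id | ComplexScalars => @complex.Re R end.

Lemma real_part_le x : `|real_part x| <= modulus x.
Proof.
rewrite /real_part; case: s x => //= x.
by rewrite -lecR modulusC (normc_ge_Re x).
Qed.

(** For complex scalars the real case [key] is applied to the real and imaginary parts, each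
    dominated by the modulus. *)
Lemma modulus_complete (a : nat -> K) :
  (forall e : R, 0 < e -> exists N, forall m n, (N <= m)%N -> (N <= n)%N ->
     modulus (a m - a n) < e) ->
  exists l, forall e : R, 0 < e -> exists N, forall n, (N <= n)%N ->
     modulus (a n - l) < e.
Proof.
have key (u : nat -> R) :
    (forall e : R, 0 < e -> exists N, forall m n, (N <= m)%N -> (N <= n)%N ->
      `|u m - u n| < e) ->
    exists l, forall e : R, 0 < e -> exists N, forall n, (N <= n)%N ->
      `|u n - l| < e.
  move=> uC; have : cvgn u.
    apply/cauchy_cvgP/cauchy_ballP => e e0.
    have [N NP] := uC _ e0.
    pose A : set R := u @` [set n | (N <= n)%N].
    exists (A, A); first by split; exists N => // n nN; exists n.
    by move=> [_ _] /= [[m mN <-] [n nN <-]]; rewrite -ball_normE /=; exact: NP.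
  move=> /cvg_ex[l /cvgrPdist_lt ul]; exists l => e e0.
  by have [N _ NP] := ul _ e0; exists N => n nN; rewrite distrC; exact: NP.
case: s a => //= a aC.
have Rc : forall x : complex R, modulus (x : scalar_field R ComplexScalars) <=
    `|complex.Re x| + `|complex.Im x|.
  move=> x; rewrite -lecR modulusC rmorphD /=.
  rewrite {1}[x]complexE (le_trans (ler_normD _ _))//.
  by rewrite normrM normc_def/= expr0n addr0 sqrtr_sqr lerD2l
     !normc_def/= expr0n !add0r !addr0 expr1n sqrtr1 mul1r sqrtr_sqr.
have Ic (x : complex R) : `|complex.Im x| <= modulus (x : scalar_field R ComplexScalars).
  rewrite -lecR modulusC normc_def lecR -sqrtr_sqr ler_sqrt ?addr_ge0 ?sqr_ge0//.
  by rewrite lerDr sqr_ge0.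
have Rec (x : complex R) : `|complex.Re x| <= modulus (x : scalar_field R ComplexScalars).
  rewrite -lecR modulusC normc_def lecR -sqrtr_sqr ler_sqrt ?addr_ge0 ?sqr_ge0//.
  by rewrite lerDl sqr_ge0.
have [|l1 l1P] := key (fun n => complex.Re (a n)).
  move=> e /aC[N NP]; exists N => m n mN nN.
  rewrite (le_lt_trans _ (NP _ _ mN nN))//.
  by rewrite (le_trans _ (Rec _))//; case: (a m) (a n) => ? ? [].
have [|l2 l2P] := key (fun n => complex.Im (a n)).
  move=> e /aC[N NP]; exists N => m n mN nN.
  rewrite (le_lt_trans _ (NP _ _ mN nN))//.
  by rewrite (le_trans _ (Ic _))//; case: (a m) (a n) => ? ? [].
exists (l1 +i* l2)%C => e e0.
have e2 : 0 < e / 2 by rewrite divr_gt0.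
have [N NP] := l1P _ e2; have [M MP] := l2P _ e2.
exists (maxn N M) => n; rewrite geq_max => /andP[nN nM].
rewrite (le_lt_trans (Rc _))// [ltRHS]splitr ltrD//.
  by have := NP _ nN; case: (a n).
by have := MP _ nM; case: (a n).
Qed.

End scalars.

(** * The Hahn-Banach theorem *)

Section hahn_banach.
Context (R : realType) (s : scalar_kind).
Local Notation K := (scalar_field R s).
Context (V : lmodType K).
Local Notation sc := (@scal R s).
Implicit Types (p u : V -> R) (x y : V).

(** Homogeneity is asked only as an inequality, the form that passes to infima; [sublinearZ]
    recovers equality by rescaling with the inverse of [t]. *)
Definition sublinear p :=
  (forall x y, p (x + y) <= p x + p y) /\
  (forall t x, 0 <= t -> p (sc t *: x) <= t * p x).

Definition real_linear u :=
  (forall x y, u (x + y) = u x + u y) /\ (forall t x, u (sc t *: x) = t * u x).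

Lemma sublinear0 p : sublinear p -> p 0 = 0.
Proof.
move=> [pD pZ]; apply/eqP; rewrite eq_le; apply/andP; split.
  by have := pZ 0 0 (lexx 0); rewrite scaler0 mul0r.
by have := pD 0 0; rewrite addr0 -lerBlDr subrr.
Qed.

Lemma sublinearZ p t x : sublinear p -> 0 <= t -> p (sc t *: x) = t * p x.
Proof.
move=> psub; have [pD pZ] := psub.
rewrite le_eqVlt => /orP[/eqP<-|t0].
  by rewrite scal0 scale0r mul0r sublinear0.
apply/eqP; rewrite eq_le (pZ _ _ (ltW t0))/= -ler_pdivlMl//.
rewrite -{1}[x]scale1r -(scal1 R s) -(@mulVf _ t) ?gt_eqF// scalM -scalerA.
by apply: pZ; rewrite invr_ge0 ltW.
Qed.

Lemma sublinear_geN p x : sublinear p -> - p (- x) <= p x.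
Proof.
move=> psub; rewrite lerNl -subr_ge0 opprK addrC -(sublinear0 psub) -(subrr x).
exact: psub.1.
Qed.

(** Serves both infima of the Hahn-Banach proof: over the shifts of [p] and over chains in Zorn's
    lemma. The competitor [h] may depend on the points, so directedness is pointwise. *)
Lemma sublinear_inf (Phi : set (V -> R)) : Phi !=set0 ->
  (forall x, exists b, forall f, Phi f -> b <= f x) ->
  (forall f g x y, Phi f -> Phi g ->
     exists2 h, Phi h & h (x + y) <= f x + g y) ->
  (forall f t x, Phi f -> 0 <= t ->
     exists2 h, Phi h & h (sc t *: x) <= t * f x) ->
  exists2 i, sublinear i & forall f x, Phi f -> i x <= f x.
Proof.
move=> [f0 Pf0] lb PD PZ.
pose A x := [set f x | f in Phi].
have A0 x : A x !=set0 by exists (f0 x), f0.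
have Alb x : has_lbound (A x).
  by have [b bP] := lb x; exists b => _ [f Pf <-]; exact: bP.
have infP f x : Phi f -> inf (A x) <= f x by move=> Pf; apply: ge_inf => //; exists f.
exists (fun x => inf (A x)) => //; split.
  move=> x y; apply/ler_addgt0Pr => e e0.
  have e2 : 0 < e / 2 by rewrite divr_gt0.
  have [_ [f Pf <-] fx] := inf_adherent e2 (conj (A0 x) (Alb x)).
  have [_ [g Pg <-] gy] := inf_adherent e2 (conj (A0 y) (Alb y)).
  have [h Ph hxy] := PD _ _ x y Pf Pg.
  by have := infP _ (x + y) Ph; lra.
move=> t x t0; move: (t0); rewrite le_eqVlt => /orP[/eqP<-|{}t0].
  have [h Ph] := PZ _ 0 x Pf0 (lexx 0).
  by rewrite !mul0r; apply: le_trans; exact: infP.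
rewrite mulrC -ler_pdivrMr//; apply: lb_le_inf => // _ [f Pf <-].
rewrite ler_pdivrMr// mulrC; have [h Ph] := PZ _ _ x Pf (ltW t0).
by apply: le_trans; exact: infP.
Qed.

(** The functional is the infimum of p (x + t y) - t p y over t >= 0. The members t = 0 and t = 1
    give the two bounds; subadditivity bounds the infimum below by - p (- x). *)
Lemma sublinear_shift p y : sublinear p ->
  exists i, [/\ sublinear i, forall x, i x <= p x &
    forall x, i x <= p (x + y) - p y].
Proof.
move=> psub; have [pD pZ] := psub.
pose f t x := p (x + sc t *: y) - t * p y.
have [|x|_ _ x x' [t /= t0 <-] [r /= r0 <-]|_ r x [t /= t0 <-] r0|i isub iP] :=
  @sublinear_inf [set f t | t in [set t | 0 <= t]].
- by exists (f 0), 0 => //=.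
- exists (- p (- x)) => _ [t /= t0 <-]; rewrite /f.
  rewrite -(sublinearZ y psub t0) lerBrDr addrC.
  by have := pD (x + sc t *: y) (- x); rewrite addrAC subrr add0r; lra.
- exists (f (t + r)); first by exists (t + r) => //=; exact: addr_ge0.
  rewrite /f scalD scalerDl addrACA.
  by have := pD (x + sc t *: y) (x' + sc r *: y); lra.
- exists (f (r * t)); first by exists (r * t) => //=; exact: mulr_ge0.
  rewrite /f scalM -scalerA -scalerDr mulrBr mulrA lerD2r.
  exact: pZ.
exists i; split=> // x.
  rewrite (le_trans (iP (f 0) x _))//; first by exists 0 => /=.
  by rewrite /f scal0 scale0r addr0 mul0r subr0.
rewrite (le_trans (iP (f 1) x _))//; first by exists 1 => /=.
by rewrite /f scal1 scale1r mul1r.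
Qed.

(* A minimal sublinear functional is linear: minimality turns the shifted
   functional of [sublinear_shift] into [p] itself, so [p] is superadditive. *)
Lemma sublinear_minimal p : sublinear p ->
  exists2 u, real_linear u & forall x, u x <= p x.
Proof.
move=> psub.
pose T := {f : V -> R | sublinear f /\ forall x, f x <= p x}.
(* The order is reversed, so that a maximal element in Zorn's lemma is a minimal functional. *)
pose le (f g : T) := `[< forall x, sval g x <= sval f x >].
have [f|f g h /asboolP fg /asboolP gh|f g /asboolP fg /asboolP gf|A Atot|u umin] :=
  @Zorn T le.
- by apply/asboolP.
- by apply/asboolP => x; exact: le_trans (gh x) (fg x).
- case: f g fg gf => f fT [g gT] /= fg gf.
  have fgE : f = g by apply/funext => x; apply/eqP; rewrite eq_le fg gf.
  by rewrite fgE in fT *; congr exist; exact: Prop_irrelevance.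
- have [[f0 Af0]|A0] := pselect (A !=set0); last first.
    have pT : sublinear p /\ forall x, p x <= p x by split.
    by exists (exist _ p pT) => f Af; case: A0; exists f.
  have [|x|_ _ x y [f Af <-] [g Ag <-]|_ t x [f Af <-] t0|i isub iP] :=
    @sublinear_inf [set sval f | f in A].
  + by exists (sval f0), f0.
  + exists (- p (- x)) => _ [[f [fsub fp]] Af <-] /=.
    by rewrite (le_trans _ (sublinear_geN x fsub))// lerN2.
  + have [/asboolP fg|/asboolP gf] := Atot f g Af Ag.
      exists (sval g); first by exists g.
      by rewrite (le_trans ((svalP g).1.1 x y))// lerD2r.
    exists (sval f); first by exists f.
    by rewrite (le_trans ((svalP f).1.1 x y))// lerD2l.
  + exists (sval f); first by exists f.
    exact: (svalP f).1.2.
  have iT : sublinear i /\ forall x, i x <= p x.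
    split=> // x; rewrite (le_trans (iP (sval f0) x _))//; first by exists f0.
    exact: (svalP f0).2.
  exists (exist _ i iT) => f Af; apply/asboolP => x /=.
  by apply: iP; exists f.
have [usub up] := svalP u.
have uD x y : sval u (x + y) = sval u x + sval u y.
  apply/eqP; rewrite eq_le usub.1/=.
  have [i [isub iu ius]] := sublinear_shift y usub.
  have iT : sublinear i /\ forall x, i x <= p x.
    by split=> // z; exact: le_trans (iu z) (up z).
  have iE : i = sval u.
    by have /(congr1 sval) := umin (exist _ i iT) (asboolT iu).
  by have := ius x; rewrite iE; lra.
have uN x : sval u (- x) = - sval u x.
  by apply/eqP; rewrite -addr_eq0 -uD addNr sublinear0.
exists (sval u) => //; split=> // t x.
have [t0|/ltW t0] := leP 0 t; first exact: sublinearZ.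
by rewrite -[t]opprK scalN scaleNr uN sublinearZ ?oppr_ge0// !mulNr !opprK.
Qed.

(** Going below the shift of [p] along [x0], rather than below [p] itself, forces u (- x0) <= - p
    x0, the missing half of the equality at [x0]. *)
Lemma hahn_banach_sublinear p x0 : sublinear p ->
  exists u, [/\ real_linear u, forall x, u x <= p x & u x0 = p x0].
Proof.
move=> psub; have [i [isub ip ix0]] := sublinear_shift x0 psub.
have [u [uD uZ] ui] := sublinear_minimal isub.
have up x : u x <= p x by exact: le_trans (ui x) (ip x).
exists u; split=> //; apply/eqP; rewrite eq_le up/=.
have : u (- x0) <= - p x0.
  rewrite (le_trans (ui _))// (le_trans (ix0 _))//.
  by rewrite addNr (sublinear0 psub) add0r.
by rewrite -scaleN1r -(scal1 R s) -scalN uZ mulN1r lerN2.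
Qed.

End hahn_banach.

(** * Continuous seminorms *)

Section seminorms.
Context (R : realType) (s : scalar_kind).
Local Notation K := (scalar_field R s).
Local Notation sc := (@scal R s).

Definition seminorm (V : lmodType K) (p : V -> R) :=
  (forall x y, p (x + y) <= p x + p y) /\
  (forall c x, p (c *: x) = modulus c * p x).

Section seminorm_theory.
Context (V : lmodType K) (p : V -> R) (psemi : seminorm p).
Implicit Types x y : V.

Lemma seminorm0 : p 0 = 0.
Proof. by rewrite -(scale0r 0) psemi.2 modulus0 mul0r. Qed.

Lemma seminormN x : p (- x) = p x.
Proof. by rewrite -scaleN1r psemi.2 modulusN1 mul1r. Qed.

Lemma seminorm_ge0 x : 0 <= p x.
Proof.
have := psemi.1 x (- x); rewrite subrr seminorm0 seminormN -mulr2n.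
by rewrite pmulrn_lge0.
Qed.

Lemma seminormBC x y : p (x - y) = p (y - x).
Proof. by rewrite -seminormN opprB. Qed.

Lemma seminorm_triangle y x z : p (x - z) <= p (x - y) + p (y - z).
Proof. by rewrite -{1}(subrK y x) -addrA psemi.1. Qed.

Lemma seminorm_leD x y : p x <= p (x + y) + p y.
Proof. by rewrite -{1}(addrK y x) -(seminormN y) psemi.1. Qed.

Lemma seminorm_sum (I : Type) (r : seq I) (P : pred I) (f : I -> V) :
  p (\sum_(i <- r | P i) f i) <= \sum_(i <- r | P i) p (f i).
Proof.
elim/big_ind2 : _ => //; first by rewrite seminorm0.
by move=> a b c d ab cd; rewrite (le_trans (psemi.1 _ _))// lerD.
Qed.

Lemma seminorm_sublinear : sublinear p.
Proof.
by split=> [|t x t0]; [exact: psemi.1|rewrite psemi.2 modulus_scal ger0_norm].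
Qed.

End seminorm_theory.

Lemma seminorm_add (V : lmodType K) (p q : V -> R) :
  seminorm p -> seminorm q -> seminorm (fun x => p x + q x).
Proof.
move=> [pD pZ] [qD qZ]; split=> [x y|c x]; last by rewrite pZ qZ mulrDr.
by have := pD x y; have := qD x y; lra.
Qed.

Lemma seminorm_scale (V : lmodType K) (p : V -> R) (a : R) : 0 <= a ->
  seminorm p -> seminorm (fun x => a * p x).
Proof.
move=> a0 [pD pZ]; split=> [x y|c x]; last by rewrite pZ mulrCA.
by rewrite -mulrDr ler_wpM2l.
Qed.

Lemma linear_funB (V W : lmodType K) (f : V -> W) x y :
  linear f -> f (x - y) = f x - f y.
Proof. by move=> flin; rewrite [x - y]addrC -scaleN1r flin scaleN1r addrC. Qed.

Lemma linear_fun0 (V W : lmodType K) (f : V -> W) : linear f -> f 0 = 0.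
Proof. by move=> flin; rewrite -(subrr 0) (linear_funB _ _ flin) subrr. Qed.

Lemma seminorm_comp (V W : lmodType K) (f : V -> W) (p : W -> R) :
  linear f -> seminorm p -> seminorm (fun x => p (f x)).
Proof.
move=> flin psemi; split=> [x y|c x].
  by rewrite -{1}[x]scale1r flin scale1r psemi.1.
by rewrite -[c *: x]addr0 flin (linear_fun0 flin) addr0 psemi.2.
Qed.

(** Real-valued counterpart of [continuous_seminorm]; smallness near 0 suffices, since translations
    and the triangle inequality give continuity elsewhere. *)
Definition cts_seminorm (E : tvsType K) (p : E -> R) :=
  seminorm p /\ forall e, 0 < e -> nbhs 0 [set x | p x < e].

Section gauge.
Context (E : tvsType K).
Implicit Types (x y : E) (A U : set E).

Lemma nbhs0_scale_nbhs A : nbhs 0 A -> exists2 d : R, 0 < d &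
  exists2 Q : set E, nbhs 0 Q & forall c x, modulus c < d -> Q x -> A (c *: x).
Proof.
move=> A0; have := @scale_continuous K E (0, 0) A.
rewrite /= scaler0 => /(_ A0)[[P Q]/= [/nbhs_modulusP[d d0 dP] Q0] PQ].
exists d => //; exists Q => // c x cd Qx; apply: (PQ (c, x)); split=> //.
by apply: dP; rewrite subr0.
Qed.

Lemma nbhs0_absorbing A x : nbhs 0 A ->
  exists2 d : R, 0 < d & forall c, modulus c < d -> A (c *: x).
Proof.
move=> A0; have := @scale_continuous K E (0, x) A.
rewrite /= scale0r => /(_ A0)[[P Q]/= [/nbhs_modulusP[d d0 dP] Q0] PQ].
exists d => // c cd; apply: (PQ (c, x)); split; last exact: nbhs_singleton.
by apply: dP; rewrite subr0.
Qed.

(** [A] is the balanced core of a convex basic neighborhood: joint continuity of scaling at (0, 0)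
    makes it a neighborhood, and each of its defining conditions is convex. *)
Lemma nbhs0_absconvex U : nbhs 0 U ->
  exists A, [/\ nbhs 0 A, A `<=` U,
    forall c x, modulus c <= 1 -> A x -> A (c *: x) &
    forall t x y, 0 <= t -> t <= 1 -> A x -> A y ->
      A (sc t *: x + sc (1 - t) *: y)].
Proof.
move=> U0; have [B Bconv [Bopen Bnbhs]] := @locally_convex K E.
have [C [BC C0] CU] := Bnbhs 0 _ U0.
have nC : nbhs 0 C by apply: open_nbhs_nbhs; split=> //; exact: Bopen.
have Cconv t x y : 0 <= t -> t <= 1 -> C x -> C y ->
    C (sc t *: x + sc (1 - t) *: y).
  move=> t0 t1 Cx Cy; rewrite -(scal_ge0 s) in t0.
  rewrite -(scal_le s) scal1 in t1.
  have := Bconv C (mem_set BC) x y (Itv01 t0 t1) (mem_set Cx) (mem_set Cy).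
  by move=> /set_mem; rewrite conv_lmodE/= scalB scal1.
exists [set x | forall c, modulus c <= 1 -> C (c *: x)]; split.
- have [d d0 [Q Q0 QC]] := nbhs0_scale_nbhs nC.
  have r0 : sc (d / 2) != 0 by rewrite gt_eqF// scal_gt0 divr_gt0.
  apply: filterS (nbhs0Z r0 Q0) => _ [x Qx <-] c c1; rewrite scalerA.
  apply: QC Qx; rewrite modulusM modulus_scal ger0_norm ?divr_ge0 ?ltW//.
  rewrite (@le_lt_trans _ _ (1 * (d / 2)))//; last by lra.
  by rewrite ler_wpM2r// divr_ge0 ?ltW.
- by move=> x /(_ 1); rewrite scale1r modulus1 => /(_ (lexx _)); exact: CU.
- move=> c x c1 Cx b b1; rewrite scalerA; apply: Cx.
  by rewrite modulusM mulr_ile1// modulus_ge0.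
- move=> t x y t0 t1 Cx Cy c c1; rewrite scalerDr 2!scalerA.
  by rewrite ![c * _]mulrC -2!scalerA; apply: Cconv => //; [exact: Cx|exact: Cy].
Qed.

(** Minkowski functional of an absolutely convex neighborhood [A] inside [U]: p x < 1 yields some t
    < 1 with x / t in [A], and balancedness puts x in [A]. *)
Lemma gauge_exists U : nbhs 0 U ->
  exists2 p : E -> R, cts_seminorm p & forall x, p x < 1 -> U x.
Proof.
move=> /nbhs0_absconvex[A [A0 AU Abal Aconv]].
pose S x := [set t : R | 0 < t /\ A (sc t^-1 *: x)].
have S0 x : S x !=set0.
  have [d d0 dA] := nbhs0_absorbing x A0; exists (2 / d); split.
    by rewrite divr_gt0.
  rewrite invf_div; apply: dA; rewrite modulus_scal gtr0_norm ?divr_gt0//.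
  by lra.
have Slb x : has_lbound (S x) by exists 0 => t [/ltW].
pose p x := inf (S x).
have pS t x : S x t -> p x <= t by move=> Sxt; exact: ge_inf.
have p_ge0 x : 0 <= p x by apply: lb_le_inf => // t [/ltW].
have pD x y : p (x + y) <= p x + p y.
  apply/ler_addgt0Pr => e e0.
  have e2 : 0 < e / 2 by rewrite divr_gt0.
  have [t [t0 At] tx] := inf_adherent e2 (conj (S0 x) (Slb x)).
  have [r [r0 Ar] ry] := inf_adherent e2 (conj (S0 y) (Slb y)).
  suff : p (x + y) <= t + r by rewrite -/(p x) -/(p y) in tx ry; lra.
  apply: pS; split; first exact: addr_gt0.
  have tr0 : 0 < t + r by exact: addr_gt0.
  rewrite scalerDr.
  (* (x + y) / (t + r) is the convex combination of x / t and y / r with weight t / (t + r). *)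
  rewrite (_ : _ + _ = sc (t / (t + r)) *: (sc t^-1 *: x) +
    sc (1 - t / (t + r)) *: (sc r^-1 *: y)).
    by apply: Aconv => //; [exact/divr_ge0/ltW/tr0/ltW|rewrite ler_pdivrMr// mul1r lerDl ltW].
  rewrite !scalerA -!scalM; congr (sc _ *: _ + sc _ *: _); field.
    by rewrite !gt_eqF.
  by rewrite !gt_eqF.
have pZle c x : c != 0 -> p (c *: x) <= modulus c * p x.
  move=> c0; have m0 : 0 < modulus c.
    rewrite lt_neqAle modulus_ge0 andbT eq_sym.
    by apply: contra_neq c0; exact: modulus_eq0.
  rewrite -ler_pdivrMl//; apply: lb_le_inf => // t [t0 At].
  rewrite ler_pdivrMl//; apply: pS; split; first exact: mulr_gt0.
  rewrite (_ : _ *: _ = (sc (modulus c)^-1 * c) *: (sc t^-1 *: x)).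
    apply: Abal => //; rewrite modulusM modulus_scal gtr0_norm ?invr_gt0//.
    by rewrite mulVf ?gt_eqF.
  by rewrite !scalerA invfM scalM; congr (_ *: _); ring.
have p0 : p 0 = 0.
  apply/eqP; rewrite eq_le p_ge0 andbT.
  apply/ler_addgt0Pr => e e0; rewrite add0r; apply: pS; split=> //.
  by rewrite scaler0; exact: nbhs_singleton.
have pZ c x : p (c *: x) = modulus c * p x.
  have [->|c0] := eqVneq c 0; first by rewrite scale0r p0 modulus0 mul0r.
  have m0 : 0 < modulus c.
    rewrite lt_neqAle modulus_ge0 andbT eq_sym.
    by apply: contra_neq c0; exact: modulus_eq0.
  (* The reverse inequality is [pZle] for the inverse of c, applied to c x. *)
  apply/eqP; rewrite eq_le pZle//= -ler_pdivlMl//.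
  rewrite -{1}[x]scale1r -(mulVf c0) -scalerA -modulusV.
  by apply: pZle; rewrite invr_eq0.
exists p.
  split; first by split.
  move=> e e0; have r0 : sc (e / 2) != 0 by rewrite gt_eqF// scal_gt0 divr_gt0.
  apply: filterS (nbhs0Z r0 A0) => _ [x Ax <-] /=.
  rewrite (@le_lt_trans _ _ (e / 2))//; last by lra.
  apply: pS; split; first by rewrite divr_gt0.
  by rewrite scalerA -scalM mulVf ?gt_eqF ?divr_gt0// scal1 scale1r.
move=> x; rewrite -subr_gt0 => p1.
have [t [t0 At] tx] := inf_adherent p1 (conj (S0 x) (Slb x)).
rewrite addrC subrK in tx; apply: AU.
have := Abal (sc t) _ _ At; rewrite scalerA -scalM mulfV ?gt_eqF// scal1 scale1r.
by apply; rewrite modulus_scal gtr0_norm// ltW.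
Qed.

Lemma nbhs_seminormP x A : nbhs x A <->
  exists2 p : E -> R, cts_seminorm p & forall y, p (y - x) < 1 -> A y.
Proof.
split=> [xA|[p [psemi pn] pA]].
  have := nbhsB (- x) xA; rewrite addNr => /gauge_exists[p pc pA].
  exists p => // y /pA[z Az]; rewrite [y - x]addrC => /addrI zy.
  by rewrite -zy.
apply: filterS (nbhsT x (pn _ ltr01)) => _ [y /= y1 <-].
by apply: pA; rewrite addrC addKr.
Qed.

Lemma cts_seminorm_nbhs p x e : cts_seminorm p -> 0 < e ->
  nbhs x [set y | p (y - x) < e].
Proof.
move=> [psemi pn] e0.
apply: filterS (nbhsT x (pn _ e0)) => _ [y /= y1 <-].
by rewrite addrC addKr.
Qed.

Lemma cts_seminormD p q : cts_seminorm p -> cts_seminorm q ->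
  cts_seminorm (fun x => p x + q x).
Proof.
move=> [ps pn] [qs qn]; split; first exact: seminorm_add.
move=> e e0; have e2 : 0 < e / 2 by rewrite divr_gt0.
by apply: filterS2 (pn _ e2) (qn _ e2) => x /=; lra.
Qed.

Lemma cts_seminormZ p a : 0 <= a -> cts_seminorm p ->
  cts_seminorm (fun x => a * p x).
Proof.
move=> a0 [ps pn]; split; first exact: seminorm_scale.
move=> e e0; have ea : 0 < e / (a + 1) by rewrite divr_gt0// ltr_wpDl.
apply: filterS (pn _ ea) => x /=; rewrite ltr_pdivlMr ?ltr_wpDl// => xe.
rewrite (le_lt_trans _ xe)// mulrC ler_wpM2l ?lerDl//.
exact: seminorm_ge0.
Qed.

Lemma cts_seminorm0 : cts_seminorm (fun _ : E => 0 : R).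
Proof.
split; first by split=> [x y|c x]; [rewrite addr0|rewrite mulr0].
by move=> e e0; apply: filterS filterT => x _ /=.
Qed.

Lemma cts_seminorm_sum (p : nat -> E -> R) n : (forall i, cts_seminorm (p i)) ->
  cts_seminorm (fun x => \sum_(i < n) p i x).
Proof.
move=> pc; elim: n => [|n IH].
  have -> : (fun x => \sum_(i < 0) p i x) = (fun=> 0).
    by apply/funext => x; rewrite big_ord0.
  exact: cts_seminorm0.
have -> : (fun x => \sum_(i < n.+1) p i x) = (fun x => \sum_(i < n) p i x + p n x).
  by apply/funext => x; rewrite big_ord_recr.
exact: cts_seminormD.
Qed.

Lemma cts_seminorm_le p q : cts_seminorm p -> seminorm q ->
  (forall x, q x <= p x) -> cts_seminorm q.
Proof.
move=> [ps pn] qs qp; split=> // e e0; apply: filterS (pn _ e0) => x /=.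
exact: le_lt_trans.
Qed.

End gauge.

Lemma hausdorff_seminorm (E : tvsType K) (x : E) : hausdorff_space E ->
  (forall p, cts_seminorm p -> p x = 0) -> x = 0.
Proof.
move=> hE px; apply: hE => A B xA /nbhs_seminormP[p pc pB].
exists x; split; first exact: nbhs_singleton.
by apply: pB; rewrite subr0 px.
Qed.

Lemma cts_seminorm_comp (E F : tvsType K) (f : E -> F) q : linear f ->
  continuous f -> cts_seminorm q -> cts_seminorm (fun x => q (f x)).
Proof.
move=> flin fc [qs qn]; split; first exact: seminorm_comp.
move=> e e0; have := fc 0 [set y | q y < e]; apply.
by rewrite (linear_fun0 flin); exact: qn.
Qed.

Lemma seminorm_modulus : seminorm (@modulus R s : K^o -> R).
Proof. by split=> [x y|c x]; [exact: modulusD|exact: modulusM]. Qed.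

Lemma cts_seminorm_modulus : cts_seminorm (@modulus R s : K^o -> R).
Proof.
split; first exact: seminorm_modulus.
move=> e e0; apply: filterS (nbhs_modulus 0 e0) => x /=.
by rewrite subr0.
Qed.

Section dual_seminorm.
Context (E : tvsType K).
Implicit Type f : E -> K^o.

Lemma dual_seminorm f : dual f -> cts_seminorm (fun x => modulus (f x)).
Proof.
move=> [flin fc].
exact: (@cts_seminorm_comp E K^o f _ flin fc cts_seminorm_modulus).
Qed.

Lemma dual_le f p : linear f -> cts_seminorm p ->
  (forall x, modulus (f x) <= p x) -> dual f.
Proof.
move=> flin pc fp; split=> // x A /nbhs_modulusP[e e0 eA].
apply: filterS (cts_seminorm_nbhs x pc e0) => y /= yx; apply: eA.
rewrite (le_lt_trans _ yx)//; apply: le_trans (fp (y - x)).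
by rewrite (linear_funB _ _ flin).
Qed.

End dual_seminorm.
End seminorms.

(** In the complex case f x = u x - i u (i x). Estimating the two terms separately gives 2 q instead
    of the sharp q, which is enough for continuity. *)
Lemma complexify (R : realType) (s : scalar_kind) (V : lmodType (scalar_field R s))
    (u : V -> R) : real_linear u ->
  exists f : V -> (scalar_field R s)^o,
  [/\ linear f, forall x, real_part (f x : scalar_field R s) = u x &
    forall q, seminorm q -> (forall x, u x <= q x) ->
      forall x, modulus (f x : scalar_field R s) <= q x + q x].
Proof.
move=> ulin.
have ule q x : seminorm q -> (forall x, u x <= q x) -> `|u x| <= q x.
  move=> qs uq; rewrite ler_norml uq andbT.
  have := uq (- x); rewrite (seminormN qs) -scaleN1r -(scal1 R s) -scalN ulin.2.
  by rewrite mulN1r lerNl.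
move: ulin; case: s V u ule => V u ule [uD uZ].
  exists u; split=> // [c x y|q qs uq x].
    by rewrite uD; congr (_ + _); exact: uZ.
  by rewrite (le_trans (ule _ _ qs uq))// lerDl seminorm_ge0.
have uI x : u ('i%C *: ('i%C *: x)) = - u x.
  rewrite scalerA -expr2 sqr_i -(mul1r (u x)) -mulNr -uZ scalN scal1.
  by [].
exists (fun x => (u x -i* u ('i%C *: x))%C); split=> [[a b] x y|x|q qs uq x].
- have cE z : (a +i* b)%C *: z = scal ComplexScalars a *: z + scal ComplexScalars b *: ('i%C *: z).
    by rewrite scalerA -scalerDl [(a +i* b)%C]complexE mulrC.
  have iC (t : R) z : 'i%C *: (scal ComplexScalars t *: z) =
      scal ComplexScalars t *: ('i%C *: z) by rewrite !scalerA mulrC.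
  rewrite scalerDr !uD cE scalerDr !iC !uD !uZ uI.
  by apply/eqP; rewrite eq_complex /=; apply/andP; split; apply/eqP; ring.
- by [].
- have -> : (u x -i* u ('i%C *: x))%C = scal ComplexScalars (u x) - 'i%C * scal ComplexScalars (u ('i%C *: x)).
    by rewrite /= mulrC complexiE; apply/eqP; rewrite eq_complex /=; apply/andP; split; apply/eqP; ring.
  rewrite (le_trans (modulusD _ _))// modulusN modulusM !modulus_scal.
  have i1 : modulus ('i%C : scalar_field R ComplexScalars) = 1.
    by rewrite /modulus normc_def /= expr0n expr1n add0r sqrtr1.
  rewrite i1 mul1r lerD ?(ule _ _ qs uq)// (le_trans (ule _ _ qs uq))//.
  by rewrite qs.2 i1 mul1r.
Qed.

(** * Weakly bounded sets are bounded *)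

Section weakly_bounded.
Context (R : realType) (s : scalar_kind).
Local Notation K := (scalar_field R s).

Lemma archi_nat (C : R) : exists n : nat, C < n%:R.
Proof.
exists (Num.bound C); rewrite (le_lt_trans (ler_norm _))//.
by have := archi_boundP (normr_ge0 C); rewrite /Num.bound normr_id.
Qed.

Lemma geometric_small (C e : R) : 0 < e -> exists n, C * (4^-1) ^+ n < e.
Proof.
move=> e0; have [n nP] := archi_nat (C / e); exists n.
rewrite exprVn ltr_pdivrMr ?exprn_gt0// -ltr_pdivrMl// mulrC.
rewrite (lt_le_trans nP)// -natrX ler_nat ltnW//.
exact: ltn_expl.
Qed.

(* Gliding hump: step n adds 4^-n u_n, with u_n norming x_n, only if needed to
   get |f_(n+1) x_n| >= 4^-n q(x_n) / 2; all later steps together change this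
   value by at most 4^-n q(x_n) / 3. *)
Lemma weakly_bounded (E : tvsType K) (B : set E) (q : E -> R) :
  cts_seminorm q ->
  (forall f : E -> K^o, dual f -> exists C, forall x, B x -> modulus (f x) <= C) ->
  exists C, forall x, B x -> q x <= C.
Proof.
move=> qc wB; apply: contrapT => nB; have [qs qn] := qc.
(* The 6 inverts the final gain 1/2 - 1/3: the limit functional g satisfies |g x_n| >= 4^-n q(x_n) /
   6, which is then at least n. *)
have /choice[x xP] n : exists x, B x /\ 6 * n%:R * 4 ^+ n < q x.
  apply: contrapT => nx; apply: nB; exists (6 * n%:R * 4 ^+ n) => x Bx.
  by rewrite leNgt; apply/negP => qx; apply: nx; exists x.
have q_ge0 := seminorm_ge0 qs.
have /choice[u uP] n : exists u, [/\ @real_linear R s E u,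
    forall y, u y <= q y & u (x n) = q (x n)].
  exact: hahn_banach_sublinear (seminorm_sublinear qs).
pose w n : R := 4^-1 ^+ n.
have w0 n : 0 < w n by rewrite exprn_gt0.
have wS n : w n.+1 = w n / 4 by rewrite /w exprSr.
pose fix f n y {struct n} : R := if n is m.+1 then
  f m y + (if `|f m (x m)| < w m * q (x m) / 2 then w m * u m y else 0) else 0.
have flin n : @real_linear R s E (f n).
  elim: n => [|n [fD fZ]]; first by split=> [a b|a b] /=; rewrite ?addr0 ?mulr0.
  have [[uD uZ] _ _] := uP n.
  by split=> [a b|a b] /=; case: ifP => _; rewrite ?fD ?fZ ?uD ?uZ; ring.
have uq n y : `|u n y| <= q y.
  have [[uD uZ] uq _] := uP n; rewrite ler_norml uq andbT.
  have := uq (- y); rewrite (seminormN qs) -scaleN1r -(scal1 R s) -scalN uZ.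
  by rewrite mulN1r lerNl.
have fS n y : `|f n.+1 y - f n y| <= w n * q y.
  rewrite /= addrAC subrr add0r; case: ifP => _.
    by rewrite normrM gtr0_norm// ler_wpM2l// ltW.
  by rewrite normr0 mulr_ge0// ltW.
have fx n : w n * q (x n) / 2 <= `|f n.+1 (x n)|.
  rewrite /=; have [_ _ ->] := uP n.
  case: ltP => [fl|]; last by rewrite addr0.
  have wq0 : 0 <= w n * q (x n) by rewrite mulr_ge0// ltW.
  have := lerB_normD (w n * q (x n)) (f n (x n)).
  by rewrite (ger0_norm wq0) [_ + f n _]addrC; lra.
(* The factor is the exact sum of 4^-j for j from n to n + k - 1, so that the induction closes. *)
have fC n k y : `|f (n + k)%N y - f n y| <= 4 / 3 * (w n - w (n + k)%N) * q y.
  elim: k => [|k IH]; first by rewrite addn0 !subrr normr0 mulr0 mul0r.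
  rewrite addnS -(subrKA (f (n + k)%N y)) (le_trans (ler_normD _ _))//.
  rewrite (le_trans (lerD (fS _ _) IH))// wS.
  by rewrite le_eqVlt; apply/orP; left; apply/eqP; field.
have fC' n k y : `|f (n + k)%N y - f n y| <= 4 / 3 * w n * q y.
  rewrite (le_trans (fC _ _ _))// ler_wpM2r// ler_wpM2l//.
  by rewrite gerBl ltW.
have /choice[g gP] y : exists l, forall n, `|l - f n y| <= 4 / 3 * w n * q y.
  have [|l lP] := @modulus_complete R RealScalars (fun n => f n y).
    move=> e e0; have [N NP] := geometric_small (2 * (4 / 3) * q y) e0.
    exists N => m n /subnKC<- /subnKC<-; rewrite /modulus.
    have := ler_normB (f (N + (m - N))%N y - f N y) (f (N + (n - N))%N y - f N y).
    have := fC' N (m - N)%N y; have := fC' N (n - N)%N y.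
    rewrite opprB addrA subrK. have : 2 * (4 / 3) * q y * w N < e := NP. lra.
  exists l => n; apply/ler_addgt0Pr => e /lP[N NP].
  have := NP (n + N)%N (leq_addl _ _); rewrite /modulus => lN.
  rewrite -(subrKA (f (n + N)%N y)) (le_trans (ler_normD _ _))//.
  by rewrite addrC lerD// ?fC'// distrC ltW.
have small (a C : R) : (forall n, `|a| <= C * w n) -> a = 0.
  move=> aC; apply/eqP; rewrite -normr_le0; apply/ler_addgt0Pr => e e0.
  by have [n nC] := geometric_small C e0; rewrite add0r (le_trans (aC n))// ltW.
have glin : @real_linear R s E g.
  split=> [a b|t a].
    apply/eqP; rewrite -subr_eq0; apply/eqP.
    apply: (small _ (4 / 3 * (q (a + b) + q a + q b))) => n.
    rewrite (_ : _ - _ = (g (a + b) - f n (a + b)) - (g a - f n a) - (g b - f n b)).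
      rewrite (le_trans (ler_normB _ _))//.
      have := ler_normB (g (a + b) - f n (a + b)) (g a - f n a).
      by have := gP (a + b) n; have := gP a n; have := gP b n; lra.
    by rewrite (flin n).1; ring.
  apply/eqP; rewrite -subr_eq0; apply/eqP.
  apply: (small _ (4 / 3 * (q (scal s t *: a) + `|t| * q a))) => n.
  rewrite (_ : _ - _ = (g (scal s t *: a) - f n (scal s t *: a)) - t * (g a - f n a)).
    rewrite (le_trans (ler_normB _ _))// normrM.
    have := gP (scal s t *: a) n.
    have := ler_wpM2l (normr_ge0 t) (gP a n); lra.
  by rewrite (flin n).2; ring.
have gq y : g y <= 4 / 3 * q y.
  have := gP y 0%N; rewrite /w expr0 mulr1 /= subr0.
  by apply: le_trans; exact: ler_norm.
(* The recursion runs on real-linear functionals; only the limit is complexified. The modulus of h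
   dominates its real part g, so the lower bounds persist. *)
have [h [hlin hre hle]] := complexify glin.
have qc' : seminorm (fun y => 4 / 3 * q y) by apply: seminorm_scale.
have [|C hC] := wB h.
  apply: dual_le hlin _ (hle _ qc' gq).
  by apply: cts_seminormD; apply: cts_seminormZ.
have [n nC] := archi_nat C.
have [Bx qx] := xP n.
have := hC _ Bx; rewrite leNgt => /negP; apply; apply: lt_le_trans nC _.
rewrite (le_trans _ (real_part_le _))// hre.
have := gP (x n) n.+1; have := fx n; rewrite wS.
have wq : 6 * n%:R <= w n * q (x n).
  by rewrite /w exprVn ler_pdivlMl ?exprn_gt0// mulrC ltW.
have := ler_normB (g (x n)) (g (x n) - f n.+1 (x n)).
have -> : g (x n) - (g (x n) - f n.+1 (x n)) = f n.+1 (x n) by ring.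
by lra.
Qed.

End weakly_bounded.

(** * Construction of the basis *)

(** Growth conditions below hold only for i >= k, so finitely many terms stay arbitrary. Used both
    to sum the triangular estimates and to verify nuclearity. *)
Lemma sum_geometric_le (R : realFieldType) (b : nat -> R) k N :
  (forall i, 0 <= b i) -> (forall i, (k <= i)%N -> b i <= 2^-1 ^+ i) ->
  \sum_(i < N) b i <= \sum_(i < k) b i + 2.
Proof.
move=> b0 bk; have w0 n : 0 <= 2^-1 ^+ n :> R by rewrite exprn_ge0.
have w1 n : 2^-1 ^+ n <= 1 :> R by apply: exprn_ile1; lra.
(* Subtracting 2 * 2^-N makes the claim inductive: it is the room reserved for the remaining
   geometric tail. *)
suff : \sum_(i < N) b i <= \sum_(i < k) b i + 2 - 2 * 2^-1 ^+ N.
  by have := w0 N; lra.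
elim: N => [|N IH]; first by rewrite big_ord0 expr0 mulr1 addrK sumr_ge0.
have [Nk|kN] := ltnP N k; last first.
  by rewrite big_ord_recr/=; have := bk N kN; rewrite exprSr; lra.
suff : \sum_(i < N.+1) b i <= \sum_(i < k) b i by have := w1 N.+1; lra.
rewrite -!(big_mkord xpredT b) (@big_cat_nat _ _ _ N.+1 0 k)//= lerDl.
by rewrite sumr_ge0.
Qed.

Section triangular_basis.
Context (R : realType) (s : scalar_kind).
Local Notation K := (scalar_field R s).
Context (E F : tvsType K) (T : {linear E -> F}).
Context (p : nat -> E -> R) (q : nat -> F -> R) (D : nat -> set (F -> K^o)).
Hypotheses (psemi : forall k, seminorm (p k)) (qsemi : forall k, seminorm (q k)).
Hypotheses (pmono : forall k l x, (k <= l)%N -> p k x <= p l x)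
  (qmono : forall k l y, (k <= l)%N -> q k y <= q l y)
  (qTp : forall k x, q k (T x) <= p k x)
  (q0 : forall m y, q 0 y = 0 -> q m y = 0).
Hypotheses (Dlin : forall m f, D m f -> linear f)
  (Dle : forall m f, D m f -> forall y, modulus (f y) <= q m y)
  (Dle0 : forall m f, D m f -> exists C, forall y, modulus (f y) <= C * q 0 y)
  (Dsup : forall m y, 0 < q m y -> exists2 f, D m f & q m y <= 2 * modulus (f y)).

(** The invariant of the construction. All levels [k] are kept at once because each later vector
    must be large at every level up to its own index. *)
Definition unbounded_subspace (L : set E) :=
  linear_subspace L /\
  forall k C, exists2 x, L x & C * p k x < q k.+1 (T x).

(* Since [g] is bounded by [p 0], projecting along a vector with [g u = 1]
   is bounded for every [p k], so cutting with [ker g] preserves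
   unboundedness. *)
Lemma unbounded_subspace_ker L (g : E -> K^o) C0 : unbounded_subspace L ->
  linear g -> (forall x, modulus (g x) <= C0 * p 0 x) ->
  unbounded_subspace (L `&` [set x | g x = 0]).
Proof.
move=> [[L0 LZ] Lunb] glin gC; split.
  split; first by split=> //; exact: (linear_fun0 glin).
  move=> c x y [Lx gx] [Ly gy]; split; first exact: LZ.
  by rewrite /= glin gx gy scaler0 addr0.
move=> k C; have [[u [Lu gu]]|gL] := pselect (exists u, L u /\ g u != 0); last first.
  have [x Lx xC] := Lunb k C; exists x => //; split=> //=.
  by apply: contrapT => /eqP gx; apply: gL; exists x.
apply: contrapT => nx.
have kC x : L x -> g x = 0 -> q k.+1 (T x) <= C * p k x.
  by move=> Lx gx; rewrite leNgt; apply/negP => xC; apply: nx; exists x.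
pose v := (g u : K)^-1 *: u.
have Lv : L v by rewrite -[v]addr0; apply: LZ.
have gv : g v = 1.
  rewrite -[v]addr0 glin (linear_fun0 glin) addr0.
  exact: (mulVf (gu : (g u : K) != 0)).
have C1 : 0 <= `|C| by exact: normr_ge0.
(* The constant that domination by C on the kernel would yield on all of L, through x = y + g(x) v
   and |g x| <= |C0| p_k(x). *)
pose M := `|C| + (`|C| * p k v + q k.+1 (T v)) * `|C0|.
have [x Lx] := Lunb k M; rewrite ltNge => /negP; apply.
pose y := x - (g x : K) *: v.
have Ly : L y by rewrite /y addrC -scaleNr; exact: LZ.
have gy : g y = 0.
  rewrite /y addrC -scaleNr glin gv.
  by rewrite -[_ *: 1]/(- g x * 1 : K) mulr1 addNr.
have xE : x = y + (g x : K) *: v by rewrite subrK.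
have gx : modulus (g x) <= `|C0| * p k x.
  rewrite (le_trans (gC _))// (@le_trans _ _ (`|C0| * p 0 x))//.
    by rewrite ler_wpM2r ?ler_norm ?(seminorm_ge0 (psemi _)).
  by rewrite ler_wpM2l// pmono.
have qx : q k.+1 (T x) <= q k.+1 (T y) + modulus (g x) * q k.+1 (T v).
  by rewrite {1}xE linearD linearZ/= (le_trans ((qsemi _).1 _ _))// (qsemi _).2.
have py : p k y <= p k x + modulus (g x) * p k v.
  by rewrite (le_trans ((psemi _).1 _ _))// (seminormN (psemi _)) (psemi _).2.
have px0 := seminorm_ge0 (psemi k) x; have pv0 := seminorm_ge0 (psemi k) v.
have py0 := seminorm_ge0 (psemi k) y; have qv0 := seminorm_ge0 (qsemi k.+1) (T v).
have h1 : q k.+1 (T y) <= `|C| * p k y.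
  by rewrite (le_trans (kC _ Ly gy))// ler_wpM2r// ler_norm.
have h2 := ler_wpM2l C1 py.
have W0 : 0 <= `|C| * p k v + q k.+1 (T v) by rewrite addr_ge0 ?mulr_ge0.
have h3 := ler_wpM2l W0 gx.
rewrite /M; lra.
Qed.

Lemma unbounded_subspace_kers L (g : nat -> E -> K^o) n : unbounded_subspace L ->
  (forall i, (i < n)%N -> linear (g i) /\
     exists C, forall x, modulus (g i x) <= C * p 0 x) ->
  unbounded_subspace (L `&` [set x | forall i, (i < n)%N -> g i x = 0]).
Proof.
move=> Lu; elim: n => [|n IH] gP.
  suff -> : L `&` [set x | forall i, (i < 0)%N -> g i x = 0] = L by [].
  by apply/seteqP; split=> [x []//|x Lx]; split.
have [gl [C gC]] := gP n (ltnSn n).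
have := @unbounded_subspace_ker _ _ C (IH (fun i ni => gP i (ltnW ni))) gl gC.
congr unbounded_subspace; apply/seteqP; split=> [x [[Lx gx] gnx]|x [Lx gx]].
  split=> // i; rewrite ltnS leq_eqVlt => /orP[/eqP->//|]; exact: gx.
split; last exact: gx.
by split=> // i ni; apply: gx; exact: ltnW.
Qed.

Lemma finite_min_gt0 (d : nat -> R) n : (forall i, (i < n)%N -> 0 < d i) ->
  exists2 e, 0 < e & forall i, (i < n)%N -> e <= d i.
Proof.
elim: n => [|n IH] d0; first by exists 1.
have [e e0 ed] := IH (fun i ni => d0 i (ltnW ni)).
exists (Num.min e (d n)); first by rewrite lt_min e0 d0.
move=> i; rewrite ltnS leq_eqVlt => /orP[/eqP->|ni]; rewrite ge_min ?lexx ?orbT//.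
by rewrite ed.
Qed.

(* Adding y with [p n y] small and [q n.+1 (T y)] large keeps the inequalities
   for k < n because [q k.+1 (T y) <= p k.+1 y <= p n y]. *)
Lemma simultaneous_growth L C n : unbounded_subspace L -> 0 <= C ->
  exists2 x, L x & forall k, (k < n)%N -> C * p k x < q k.+1 (T x).
Proof.
move=> [[L0 LZ] Lunb] C0; elim: n => [|n [x Lx xn]]; first by exists 0.
(* Adding y with p_k(y) and q_{k+1}(T y) at most e costs (C + 1) e; dividing the slack by C + 2
   keeps the inequality strict. *)
have [|e e0 eP] := @finite_min_gt0 (fun k => (q k.+1 (T x) - C * p k x) / (C + 2)) n.
  by move=> i /xn xi; rewrite divr_gt0 ?subr_gt0 ?ltr_wpDl.
(* At level n nothing is known about the old x: after losing q_{n+1}(T x), B still exceeds C p_n(x)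
   + C e, which bounds C p_n(y + x). *)
pose B := C * p n x + C * e + q n.+1 (T x) + 1.
have B0 : 0 < B.
  by rewrite ltr_wpDl// !addr_ge0 ?mulr_ge0 ?(seminorm_ge0 (psemi _))
    ?(seminorm_ge0 (qsemi _))// ltW.
have [z Lz zP] := Lunb n (B / e).
have Be : 0 < B / e by rewrite divr_gt0.
have qz0 : 0 < q n.+1 (T z).
  by rewrite (le_lt_trans _ zP)// mulr_ge0 ?(seminorm_ge0 (psemi _))// ltW.
pose t := B / q n.+1 (T z).
have t0 : 0 < t by rewrite divr_gt0.
pose y := scal s t *: z.
have pyt k : p k y = t * p k z by rewrite (psemi k).2 modulus_scal gtr0_norm.
have py : p n y <= e.
  rewrite pyt /t mulrAC ler_pdivrMr// [leRHS]mulrC -ler_pdivrMr//.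
  by rewrite mulrAC ltW.
have qy : q n.+1 (T y) = B.
  by rewrite linearZ/= (qsemi _).2 modulus_scal gtr0_norm// /t divfK// gt_eqF.
exists (y + x); first exact: LZ.
move=> k; rewrite ltnS leq_eqVlt => /orP[/eqP->|kn].
  have := (psemi n).1 y x.
  have := seminorm_leD (qsemi n.+1) (T y) (T x); rewrite -linearD qy.
  move=> h1 h2; have := ler_wpM2l C0 h2; have := ler_wpM2l C0 py.
  rewrite /B in h1 *; lra.
have := eP _ kn; rewrite ler_pdivlMr ?ltr_wpDl// => ek.
have := seminorm_leD (qsemi k.+1) (T x) (T y); rewrite -linearD [x + y]addrC.
have ye : q k.+1 (T y) <= e.
  by rewrite (le_trans (qTp _ _))// (le_trans _ py)// pmono.
have pye : p k y <= e by rewrite (le_trans _ py)// pmono// ltnW.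
have := (psemi k).1 y x => h2; have := ler_wpM2l C0 h2; have := ler_wpM2l C0 pye.
lra.
Qed.

Lemma unbounded_subspace_step i L : unbounded_subspace L -> exists x f L',
  [/\ unbounded_subspace L', L' `<=` L, L x &
    [/\ 0 < q 0 (T x), forall k, (k <= i)%N -> 6 ^+ i * p k x <= q k.+1 (T x) &
    forall m, (m <= i)%N -> [/\ D m (f m), q m (T x) <= 2 * modulus (f m (T x)) &
      forall z, L' z -> f m (T z) = 0]]].
Proof.
move=> Lu; have [|x Lx xP] := @simultaneous_growth L (6 ^+ i) i.+1 Lu.
  by rewrite exprn_ge0.
(* If q_0(T x) vanished, so would q_1(T x), against the strict inequality at k = 0. Positivity at
   level 0 then provides norming functionals at every level m. *)
have x0 : 0 < q 0 (T x).
  rewrite lt_neqAle seminorm_ge0// andbT eq_sym; apply/eqP => /(q0 1) x0.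
  have := xP 0%N isT; rewrite x0 ltNge => /negP; apply.
  by rewrite mulr_ge0 ?exprn_ge0 ?(seminorm_ge0 (psemi _)).
have /choice[f fP] m : exists f, D m f /\ q m (T x) <= 2 * modulus (f (T x)).
  have [|f Df fx] := @Dsup m (T x); last by exists f.
  by rewrite (lt_le_trans x0)// qmono.
exists x, f, (L `&` [set z | forall m, (m < i.+1)%N -> f m (T z) = 0]); split.
- apply: (@unbounded_subspace_kers L (fun m => f m \o T)) => // m _; split.
    by move=> c y z; rewrite /= linearP (Dlin (fP m).1).
  have [C fC] := Dle0 (fP m).1; exists `|C| => y.
  rewrite (le_trans (fC _))// (@le_trans _ _ (`|C| * q 0 (T y)))//.
    by rewrite ler_wpM2r ?ler_norm ?(seminorm_ge0 (qsemi _)).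
  by rewrite ler_wpM2l.
- by move=> z [].
- by [].
split=> // [k ki|m mi]; first exact/ltW/xP.
by have [Df fx] := fP m; split=> // z [_]; apply.
Qed.

Hypothesis unb : forall k C, exists x, C * p k x < q k.+1 (T x).

(** The recursion carries the current subspace together with its unboundedness. The subspaces
    decrease, so x_l with l > i lies in the kernels cut out at step i: this is the triangularity. *)
Lemma triangular_sequence : exists (x : nat -> E) (f : nat -> nat -> F -> K^o),
  forall i, [/\ 0 < q 0 (T (x i)),
    forall k, (k <= i)%N -> 6 ^+ i * p k (x i) <= q k.+1 (T (x i)) &
    forall m, (m <= i)%N -> [/\ D m (f i m),
      q m (T (x i)) <= 2 * modulus (f i m (T (x i))) &
      forall l, (i < l)%N -> f i m (T (x l)) = 0]].
Proof.
have setTu : unbounded_subspace setT.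
  by split=> // k C; have [x xP] := unb k C; exists x.
have /choice[st stP] (iL : nat * {L | unbounded_subspace L}) :
    exists t : E * (nat -> F -> K^o) * {L | unbounded_subspace L},
    [/\ sval t.2 `<=` sval iL.2, sval iL.2 t.1.1 &
    [/\ 0 < q 0 (T t.1.1),
     forall k, (k <= iL.1)%N -> 6 ^+ iL.1 * p k t.1.1 <= q k.+1 (T t.1.1) &
    forall m, (m <= iL.1)%N -> [/\ D m (t.1.2 m),
      q m (T t.1.1) <= 2 * modulus (t.1.2 m (T t.1.1)) &
      forall z, sval t.2 z -> t.1.2 m (T z) = 0]]].
  case: iL => i [L Lu] /=.
  have [x [f [L' [L'u L'L Lx H]]]] := unbounded_subspace_step i Lu.
  by exists (x, f, exist _ L' L'u).
pose fix Ls i := if i is j.+1 then (st (j, Ls j)).2 else exist _ setT setTu.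
have LsS i : sval (Ls i.+1) `<=` sval (Ls i) by have [] := stP (i, Ls i).
have Lsle i j : (i <= j)%N -> sval (Ls j) `<=` sval (Ls i).
  move=> /subnK <-; elim: (j - i)%N => [|k IH]; first by rewrite add0n.
  by rewrite addSn; apply: subset_trans IH; exact: LsS.
exists (fun i => (st (i, Ls i)).1.1), (fun i => (st (i, Ls i)).1.2) => i.
have [_ _ [x0 xk fm]] := stP (i, Ls i); split=> // m mi.
have [Df fx fL] := fm m mi; split=> // l il; apply: fL.
have [_ Lx _] := stP (l, Ls l).
exact: (Lsle i.+1 l il).
Qed.

Lemma sum_expr3 i : \sum_(l < i) 3 ^+ l = (3 ^+ i - 1) / 2 :> R.
Proof.
elim: i => [|i IH]; first by rewrite big_ord0 expr0 subrr mul0r.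
by rewrite big_ord_recr/= IH exprS; field.
Qed.

Lemma triangular_basis : exists x : nat -> E,
  [/\ forall i, 0 < q 0 (T (x i)),
    forall i k, (k <= i)%N -> 6 ^+ i * p k (x i) <= q k.+1 (T (x i)) &
    forall k, exists B, forall (c : nat -> K) N,
      \sum_(i < N) modulus (c i) * p k (x i) <=
        B * q k.+1 (T (\sum_(i < N) c i *: x i))].
Proof.
have [x [f xfP]] := triangular_sequence.
have x0 i : 0 < q 0 (T (x i)) by have [] := xfP i.
have xm0 m i : 0 < q m (T (x i)) by rewrite (lt_le_trans (x0 i))// qmono.
exists x; split=> // [i k ki|k]; first by have [_ + _] := xfP i; apply.
have p_ge0 j z := seminorm_ge0 (psemi j) z.
have q_ge0 j z := seminorm_ge0 (qsemi j) z.
(* Apply f_{i,m} to the sum: terms beyond i vanish, those before i are estimated by q_m, and the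
   factor 2 comes from near norming. *)
have coef m (c : nat -> K) N i : (i < N)%N -> (m <= i)%N ->
    modulus (c i) * q m (T (x i)) <=
    2 * (q m (T (\sum_(i < N) c i *: x i)) +
         \sum_(l < i) modulus (c l) * q m (T (x l))).
  move=> iN mi; have [_ _ /(_ _ mi)[Df fx fl]] := xfP i.
  have fsum : f i m (T (\sum_(i < N) c i *: x i)) =
      c i * f i m (T (x i)) + \sum_(l < i) c l * f i m (T (x l)).
    have fD a b : f i m (a + b) = f i m a + f i m b.
      by rewrite -[a]scale1r (Dlin Df) !scale1r.
    have fZ (a : K) b : f i m (a *: b) = a * f i m b.
      by rewrite -[a *: b]addr0 (Dlin Df) (linear_fun0 (Dlin Df)) addr0.
    elim: N iN => // N IH; rewrite ltnS leq_eqVlt big_ord_recr/= linearD fD.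
    rewrite linearZ fZ/= => /orP[/eqP <-|iN]; last by rewrite fl// mulr0 addr0 IH.
    rewrite addrC; congr (_ + _); rewrite linear_sum/=.
    rewrite (big_morph (f i m) fD (linear_fun0 (Dlin Df))).
    by apply: eq_bigr => l _; rewrite linearZ fZ.
  have h1 : modulus (c i) * modulus (f i m (T (x i))) <=
      q m (T (\sum_(i < N) c i *: x i)) + \sum_(l < i) modulus (c l) * q m (T (x l)).
    rewrite -modulusM.
    have -> : c i * f i m (T (x i)) = f i m (T (\sum_(i < N) c i *: x i)) -
        \sum_(l < i) c l * f i m (T (x l)) by rewrite fsum addrK.
    rewrite (le_trans (modulusD _ _))// modulusN lerD ?(Dle Df)//.
    rewrite (le_trans (modulus_sum _ _ _))// ler_sum// => l _.
    by rewrite modulusM ler_wpM2l ?modulus_ge0 ?(Dle Df).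
  have h2 := ler_wpM2l (modulus_ge0 (c i)) fx.
  by rewrite (le_trans h2)// mulrCA ler_wpM2l.
have coef3 m : exists2 A, 0 <= A & forall (c : nat -> K) N i, (i < N)%N ->
    modulus (c i) * q m (T (x i)) <= A * 3 ^+ i * q m (T (\sum_(i < N) c i *: x i)).
  (* The bound 2 A 3^i Q reproduces itself under [coef], since 2 (Q + A (3^i - 1) Q) <= 2 A 3^i Q
     for A >= 1. Indices i < n have no functional for q_n and must be supplied separately. *)
  have ind (c : nat -> K) N A n : 1 <= A ->
      let Q := q n (T (\sum_(i < N) c i *: x i)) in
      (forall i, (i < n)%N -> (i < N)%N ->
        modulus (c i) * q n (T (x i)) <= 2 * A * 3 ^+ i * Q) ->
      forall i, (i < N)%N -> modulus (c i) * q n (T (x i)) <= 2 * A * 3 ^+ i * Q.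
    move=> A1 Q small i; have [j] := ubnP i; elim: j i => // j IH i ij iN.
    have [ni|//] := leqP n i; last by move=> ni; exact: small.
    rewrite (le_trans (coef _ _ _ _ iN ni))// -/Q.
    have Q0 : 0 <= Q by exact: q_ge0.
    have : \sum_(l < i) modulus (c l) * q n (T (x l)) <=
        \sum_(l < i) 3 ^+ l * (2 * A * Q).
      apply: ler_sum => l _.
      rewrite (_ : _ * (2 * A * Q) = 2 * A * 3 ^+ l * Q); last by ring.
      by apply: IH; [exact: leq_trans (ltn_ord l) ij|exact: ltn_trans iN].
    rewrite -mulr_suml sum_expr3.
    have := ler_wpM2r Q0 A1; rewrite mul1r; lra.
  have ind0 (c : nat -> K) N i : (i < N)%N ->
      modulus (c i) * q 0 (T (x i)) <= 2 * 3 ^+ i * q 0 (T (\sum_(i < N) c i *: x i)).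
    by move=> iN; have := ind c N 1 0%N (lexx 1) _ i iN; rewrite mulr1; apply.
  (* For the finitely many i < m the q_0 estimate is transferred to q_m by the ratio of the two
     seminorms at T x_i; the summand 1 gives rho >= 1, as [ind] requires. *)
  pose rho := 1 + \sum_(i < m) q m (T (x i)) / q 0 (T (x i)).
  have rho_ge0 i : 0 <= q m (T (x i)) / q 0 (T (x i)) by rewrite divr_ge0.
  have rho1 : 1 <= rho by rewrite lerDl sumr_ge0.
  exists (2 * rho); first by rewrite mulr_ge0// (le_trans _ rho1).
  move=> c N; apply: ind => // i im iN.
  have rhoi : q m (T (x i)) / q 0 (T (x i)) <= rho.
    rewrite /rho (bigD1 (Ordinal im))//= addrCA lerDl addr_ge0// sumr_ge0//.
  have -> : modulus (c i) * q m (T (x i)) = modulus (c i) * q 0 (T (x i)) *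
      (q m (T (x i)) / q 0 (T (x i))).
    by field; rewrite gt_eqF.
  rewrite (_ : 2 * rho * _ * _ = 2 * 3 ^+ i * q m (T (\sum_(i < N) c i *: x i)) * rho);
    last by ring.
  apply: ler_pM => //; first by rewrite mulr_ge0 ?modulus_ge0.
  rewrite (le_trans (ind0 _ _ _ iN))// ler_wpM2l ?mulr_ge0 ?exprn_ge0//.
  exact: qmono.
have [A A0 AP] := coef3 k.+1.
(* tau_i <= 6^-i once i >= k, so tau_i 3^i <= 2^-i absorbs the growth of the coefficient bounds. *)
pose tau i := p k (x i) / q k.+1 (T (x i)).
have tau_ge0 i : 0 <= tau i by rewrite divr_ge0.
have tau_small i : (k <= i)%N -> tau i * 3 ^+ i <= 2^-1 ^+ i.
  move=> ki; have [_ /(_ _ ki) xi _] := xfP i.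
  rewrite /tau mulrAC ler_pdivrMr// exprVn ler_pdivlMl ?exprn_gt0//.
  rewrite mulrC -mulrA -exprMn_comm; last exact: mulrC.
  by rewrite -natrM mulrC.
pose S := \sum_(i < k) tau i * 3 ^+ i.
have tau_sum N : \sum_(i < N) tau i * 3 ^+ i <= S + 2.
  apply: (@sum_geometric_le _ (fun i => tau i * 3 ^+ i)) => // i.
  by rewrite mulr_ge0 ?exprn_ge0.
exists (A * (S + 2)) => c N; set Q := q k.+1 _.
have Q0 : 0 <= Q by exact: q_ge0.
rewrite (@le_trans _ _ (\sum_(i < N) tau i * 3 ^+ i * (A * Q)))//.
  apply: ler_sum => i _.
  have := ler_wpM2l (tau_ge0 i) (AP c N i (ltn_ord i)); rewrite -/Q.
  have -> : tau i * (modulus (c i) * q k.+1 (T (x i))) = modulus (c i) * p k (x i).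
    by rewrite /tau; field; rewrite gt_eqF.
  suff -> : tau i * (A * 3 ^+ i * Q) = tau i * 3 ^+ i * (A * Q) by [].
  by ring.
rewrite -mulr_suml [leRHS]mulrAC mulrC ler_wpM2l ?mulr_ge0// (tau_sum N).
Qed.

End triangular_basis.

(** * Seminorms on F provided by property (y) *)

Section property_y_seminorms.
Context (R : realType) (s : scalar_kind).
Local Notation K := (scalar_field R s).

(** Only p x < 1 guarantees membership in [V], so x is divided by p x + e; this also covers p x =
    0. *)
Lemma polar_le (E : tvsType K) (V : set E) p f : seminorm p ->
  (forall x, p x < 1 -> V x) -> polar V f ->
  forall x, modulus (f x : K) <= p x.
Proof.
move=> ps pV [[flin _] fV] x; apply/ler_addgt0Pr => e e0.
have t0 : 0 < p x + e by rewrite ltr_wpDl// (seminorm_ge0 ps).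
have : V (scal s (p x + e)^-1 *: x).
  apply: pV; rewrite ps.2 modulus_scal gtr0_norm ?invr_gt0// mulrC.
  by rewrite ltr_pdivrMr// mul1r ltrDl.
move=> /fV; rewrite -[_ *: x]addr0 flin (linear_fun0 flin) addr0.
rewrite [_ *: _]/(_ * f x : K) normE -(scal1 R s) scal_le modulusM modulus_scal.
by rewrite gtr0_norm ?invr_gt0// ler_pdivrMl// mulr1.
Qed.

Context (F : tvsType K) (U1 : set F) (V : nat -> set F).
Hypotheses (U10 : nbhs 0 U1) (V0 : forall m, nbhs 0 (V m))
  (VU1 : forall m, V m `<=` U1) (Vmono : forall k l, (k <= l)%N -> V l `<=` V k)
  (Vbase : forall U, nbhs 0 U -> exists m, V m `<=` U)
  (yF : @dual _ F = \bigcup_(U in nbhs (0 : F))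
                weak_star_closure (polar_span U1 `&` polar U)).

(** The sets under the weak-star closure in property (y), taken along a decreasing countable base of
    neighborhoods inside [U1]. *)
Definition ydual m : set (F -> K^o) := polar_span U1 `&` polar (V m).

Definition ynorm m (y : F) : R := sup [set modulus (f y : K) | f in ydual m].

Lemma ydual_lin m f : ydual m f -> linear f.
Proof. by move=> [_ [[]]]. Qed.

Lemma ydual0 m : ydual m (fun=> 0).
Proof.
have P0 U : nbhs 0 U -> polar U (fun _ : F => 0 : K^o).
  move=> U0; split; last by move=> x _; rewrite normr0.
  apply: (dual_le _ (@cts_seminorm0 R s F)); last by move=> x; rewrite modulus0.
  by move=> c x y; rewrite addr0 scaler0.
split; last exact: P0.
exists 0%N => //; exists (fun=> 0); first exact: P0.
by apply/funext => x; rewrite mulr0.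
Qed.

Lemma polar_sub (A B : set F) : A `<=` B -> polar B `<=` polar A.
Proof. by move=> AB f [fd fB]; split=> // x /AB; exact: fB. Qed.

Lemma ydual_mono k l : (k <= l)%N -> ydual k `<=` ydual l.
Proof. by move=> kl f [fs fp]; split=> //; exact: polar_sub (Vmono kl) _ fp. Qed.

Lemma ynorm_bound m : exists2 g, cts_seminorm g &
  forall f, ydual m f -> forall y, modulus (f y : K) <= g y.
Proof.
have [g [gs gn] gV] := gauge_exists (V0 m).
by exists g => // f [_ fp]; exact: (polar_le gs gV fp).
Qed.

Lemma ynorm_has_sup m y : has_sup [set modulus (f y : K) | f in ydual m].
Proof.
split; first by exists (modulus (0 : K)), (fun=> 0) => //; exact: ydual0.
have [g _ gP] := ynorm_bound m.
by exists (g y) => _ [f Df <-]; exact: gP.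
Qed.

Lemma ydual_le m f : ydual m f -> forall y, modulus (f y : K) <= ynorm m y.
Proof.
move=> Df y; apply: ub_le_sup; last by exists f.
exact: (ynorm_has_sup m y).2.
Qed.

Lemma ynorm_le m y C : (forall f, ydual m f -> modulus (f y : K) <= C) ->
  ynorm m y <= C.
Proof.
move=> fC; apply: ge_sup; first exact: (ynorm_has_sup m y).1.
by move=> _ [f Df <-]; exact: fC.
Qed.

Lemma ydual_funD m f y z : ydual m f -> f (y + z) = f y + f z.
Proof. by move=> /ydual_lin fl; rewrite -[y]scale1r fl !scale1r. Qed.

Lemma ydual_funZ m f (c : K) y : ydual m f -> f (c *: y) = c * f y.
Proof.
by move=> /ydual_lin fl; rewrite -[c *: y]addr0 fl (linear_fun0 fl) addr0.
Qed.

Lemma ynorm_ge0 m y : 0 <= ynorm m y.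
Proof. by have := ydual_le (ydual0 m) y; rewrite modulus0. Qed.

Lemma ynorm_seminorm m : seminorm (ynorm m).
Proof.
split=> [y z|c y].
  apply: ynorm_le => f Df; rewrite (ydual_funD _ _ Df).
  by rewrite (le_trans (modulusD _ _))// lerD ?(ydual_le Df).
have le1 (b : K) z : ynorm m (b *: z) <= modulus b * ynorm m z.
  apply: ynorm_le => f Df; rewrite (ydual_funZ _ _ Df) modulusM.
  by rewrite ler_wpM2l ?modulus_ge0 ?(ydual_le Df).
apply/eqP; rewrite eq_le le1/=.
have [->|c0] := eqVneq c 0; first by rewrite modulus0 mul0r ynorm_ge0.
have mc : 0 < modulus c.
  rewrite lt_neqAle modulus_ge0 andbT eq_sym.
  by apply: contra_neq c0; exact: modulus_eq0.
rewrite -ler_pdivlMl// -modulusV (le_trans _ (le1 _ _))//.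
by rewrite scalerA mulVf// scale1r.
Qed.

Lemma ynorm_cts m : cts_seminorm (ynorm m).
Proof.
have [g gc gP] := ynorm_bound m.
apply: cts_seminorm_le gc (ynorm_seminorm m) _ => y.
by apply: ynorm_le => f /gP.
Qed.

Lemma ynorm_mono k l y : (k <= l)%N -> ynorm k y <= ynorm l y.
Proof.
move=> kl; apply: ynorm_le => f /(ydual_mono kl) Df; exact: ydual_le.
Qed.

(** Here the span of the polar enters: f = n g with g in the polar of [U1], and the inclusion of V_0
    in [U1] puts g in [ydual 0]. The constant n depends on f, which is harmless because only
    finitely many functionals are cut with at each step. *)
Lemma ydual_le0 m f : ydual m f ->
  exists C, forall y, modulus (f y : K) <= C * ynorm 0 y.
Proof.
move=> [[n _ [g gU1 <-]] _]; exists n%:R => y.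
have nR : (n%:R : K) = scal s n%:R.
  by elim: n => [|n IH]; rewrite ?scal0// -natr1 IH -natr1 scalD scal1.
rewrite modulusM nR modulus_scal ger0_norm// ler_wpM2l//.
apply: (@ydual_le 0%N); split; last exact: polar_sub (@VU1 0) _ gU1.
by exists 1%N => //; exists g => //; apply/funext => x; rewrite mul1r.
Qed.

Lemma ynorm_eq0 m y : ynorm 0 y = 0 -> ynorm m y = 0.
Proof.
move=> y0; apply/eqP; rewrite eq_le ynorm_ge0 andbT; apply: ynorm_le => f Df.
by have [C /(_ y)] := ydual_le0 Df; rewrite y0 mulr0.
Qed.

Lemma ynorm_attain m y : 0 < ynorm m y ->
  exists2 f, ydual m f & ynorm m y <= 2 * modulus (f y : K).
Proof.
move=> y0; have e0 : 0 < ynorm m y / 2 by rewrite divr_gt0.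
have [_ [f Df <-] fy] := sup_adherent e0 (ynorm_has_sup m y).
by exists f => //; rewrite -/(ynorm m y) in fy; lra.
Qed.

(** Closure for pointwise convergence is enough: at a given y, f is within e of some h in [ydual m],
    and m comes from the neighborhood attached to f, not from y. *)
Lemma dual_ynorm f : dual f -> exists m, forall y, modulus (f y : K) <= ynorm m y.
Proof.
rewrite yF => -[U /Vbase[m VmU] [_ fU]]; exists m => y.
apply/ler_addgt0Pr => e e0.
have : nbhs (f : {ptws F -> K^o}) [set h | modulus (h y - f y : K) < e].
  exact: (@proj_continuous F (fun=> K^o) y f _ (nbhs_modulus (f y) e0)).
move=> /fU[h [[hs hU] /= hf]].
have Dh : ydual m h by split=> //; exact: polar_sub VmU _ hU.
rewrite -(subrK (h y : K) (f y)) (le_trans (modulusD _ _))// addrC.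
by rewrite lerD ?(ydual_le Dh)// modulusBC ltW.
Qed.

End property_y_seminorms.

(** * Graded seminorms on E and the basic sequence *)

Section unbounded.
Context (R : realType) (s : scalar_kind).
Local Notation K := (scalar_field R s).
Context (E F : tvsType K).
Hypotheses (frechetE : frechet E) (frechetF : frechet F) (yF : property_y F).
Context (T : {linear E -> F}) (contT : continuous T)
  (unboundedT : ~ bounded_operator T).

(** The seminorms q_k are eliminated here: q_{k+1} o T <= p_{k+1} turns the growth of T x_i into
    growth from p_k to p_{k+1}, the source of nuclearity. *)
Lemma unbounded_basis : exists (p : nat -> E -> R) (x : nat -> E),
  [/\ forall k, cts_seminorm (p k),
    forall k l z, (k <= l)%N -> p k z <= p l z,
    forall U, nbhs 0 U -> exists k, forall z, p k z < 1 -> U z &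
    [/\ forall i k, 0 < p k (x i),
      forall i k, (k <= i)%N -> 6 ^+ i * p k (x i) <= p k.+1 (x i) &
      forall k, exists2 q, cts_seminorm q & forall (c : nat -> K) N,
        \sum_(i < N) modulus (c i) * p k (x i) <=
        q (T (\sum_(i < N) c i *: x i))]].
Proof.
have [_ [B [B0 BP]] _] := frechetF; have [_ [W [W0 WP]] _] := frechetE.
have [U1 U10 yU1] := yF.
pose V m := U1 `&` [set y | forall i, (i <= m)%N -> B i y].
have V0 m : nbhs 0 (V m).
  apply: filterI => //; elim: m => [|m IH].
    by apply: filterS (B0 0%N) => y By i; rewrite leqn0 => /eqP->.
  apply: filterS2 IH (B0 m.+1) => y ym ym1 i.
  by rewrite leq_eqVlt => /orP[/eqP->//|]; exact: ym.
have VU1 m : V m `<=` U1 by move=> y [].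
have Vmono k l : (k <= l)%N -> V l `<=` V k.
  by move=> kl y [Uy ly]; split=> // i ik; apply: ly; exact: leq_trans kl.
have Vbase U : nbhs 0 U -> exists m, V m `<=` U.
  by move=> /BP[m BmU]; exists m => y [_ ym]; apply: BmU; exact: ym.
pose q := ynorm U1 V.
have qc m : cts_seminorm (q m) by exact: ynorm_cts.
have qmono k l y : (k <= l)%N -> q k y <= q l y by exact: ynorm_mono.
have /choice[g gP] n : exists g : E -> R, cts_seminorm g /\ forall x, g x < 1 -> W n x.
  by have [g gc gW] := gauge_exists (W0 n); exists g.
have Tlin : linear T by move=> c x y; rewrite linearP.
(* Adding q_k o T to the gauges builds in q_k o T <= P_k. *)
pose P k x := \sum_(i < k.+1) g i x + q k (T x).
have Pc k : cts_seminorm (P k).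
  apply: cts_seminormD; last exact: cts_seminorm_comp.
  by apply: (@cts_seminorm_sum _ _ E g k.+1) => i; exact: (gP i).1.
have g_ge0 i x : 0 <= g i x by apply: seminorm_ge0; exact: (gP i).1.1.
have Pmono k l x : (k <= l)%N -> P k x <= P l x.
  move=> kl; apply: lerD; last exact: qmono.
  rewrite -!(big_mkord xpredT (fun i => g i x)) (@big_cat_nat _ _ _ k.+1 0 l.+1)//=.
  by rewrite lerDl sumr_ge0.
(* Otherwise P_k dominates every q_m o T, so every continuous functional is bounded on the image of
   the unit ball of P_k; that image is then bounded, and T is a bounded operator. *)
have Punb k : exists m, forall C, exists x, C * P k x < q m (T x).
  apply: contrapT => nm; apply: unboundedT.
  have qP m : exists C, forall x, q m (T x) <= C * P k x.
    apply: contrapT => nC; apply: nm; exists m => C.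
    apply: contrapT => nx; apply: nC; exists C => x.
    by rewrite leNgt; apply/negP => xC; apply: nx; exists x.
  exists [set x | P k x < 1]; first exact: (Pc k).2.
  move=> U U0; have [h hc hU] := gauge_exists U0.
  have [|C hC] := weakly_bounded (B := T @` [set x | P k x < 1]) hc.
    move=> f /(dual_ynorm U10 V0 Vbase yU1)[m fm]; have [C CP] := qP m.
    exists `|C| => _ [x /= x1 <-]; rewrite (le_trans (fm _))//.
    rewrite (le_trans (CP _))// (@le_trans _ _ (`|C| * P k x))//.
      by rewrite ler_wpM2r ?ler_norm ?(seminorm_ge0 (Pc k).1).
    by rewrite ler_piMr// ltW.
  have C1 : 0 < `|C| + 1 by rewrite ltr_wpDl.
  exists (scal s (`|C| + 1)); first by rewrite scal_gt0.
  move=> y yB; exists (scal s (`|C| + 1)^-1 *: y).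
    apply: hU; rewrite hc.1.2 modulus_scal gtr0_norm ?invr_gt0//.
    rewrite ltr_pdivrMl// mulr1 (le_lt_trans (hC _ yB))//.
    by rewrite (le_lt_trans (ler_norm _))// ltrDl.
  by rewrite scalerA -scalM mulfV ?gt_eqF// scal1 scale1r.
have /choice[m mP] := Punb.
(* n_{j+1} is at least m(n_j), so q_{n_{j+1}} o T is not dominated by P_{n_j}; it also exceeds n_j,
   so the thinned system remains cofinal. *)
pose n := fix n j := if j is i.+1 then maxn (n i).+1 (m (n i)) else 0%N.
have nS j : (n j < n j.+1)%N by rewrite /= leq_max leqnn.
have nmono k l : (k <= l)%N -> (n k <= n l)%N.
  move=> /subnK <-; elim: (l - k)%N => [|i IH]; first by rewrite add0n.
  by rewrite addSn (leq_trans IH)// ltnW.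
have nge k : (k <= n k)%N by elim: k => // k IH; exact: leq_ltn_trans (nS k).
have [|||||||||||x [x0 xk xB]] := @triangular_basis R s E F T (fun k => P (n k))
    (fun k => q (n k)) (fun k => ydual U1 V (n k)).
- by move=> k; exact: (Pc _).1.
- by move=> k; exact: (qc _).1.
- by move=> k l z kl; apply: Pmono; exact: nmono.
- by move=> k l z kl; apply: qmono; exact: nmono.
- by move=> k z; rewrite lerDr sumr_ge0.
- by move=> k y; apply: ynorm_eq0.
- by move=> k f; exact: ydual_lin.
- by move=> k f; exact: ydual_le.
- by move=> k f; exact: ydual_le0.
- by move=> k y; exact: ynorm_attain.
- move=> k C; have [x xC] := mP (n k) C; exists x.
  by rewrite (lt_le_trans xC)// qmono// leq_max leqnn orbT.
have qP k z : q (n k) (T z) <= P (n k) z by rewrite lerDr sumr_ge0.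
exists (fun k => P (n k)), x; split=> //.
- by move=> k l z kl; apply: Pmono; exact: nmono.
- move=> U /WP[k WkU]; exists k => z zk; apply/WkU/(gP k).2.
  rewrite (le_lt_trans _ zk)// /P (bigD1 (Ordinal (nge k : (k < (n k).+1)%N)))//=.
  by rewrite -addrA lerDl addr_ge0 ?sumr_ge0// (seminorm_ge0 (qc _).1).
split.
- move=> i k; rewrite (lt_le_trans (x0 i))// (le_trans (qP 0%N _))//.
  exact: Pmono.
- by move=> i k ki; rewrite (le_trans (xk i k ki)).
- move=> k; have [C CP] := xB k; exists (fun y => `|C| * q (n k.+1) y).
    exact: cts_seminormZ.
  move=> c N; rewrite (le_trans (CP c N))// ler_wpM2r ?ler_norm//.
  exact: (seminorm_ge0 (qc _).1).
Qed.

End unbounded.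

(** * Koethe spaces *)

Section kothe_theory.
Context (R : realType) (s : scalar_kind) (a : kothe_matrix R).
Local Notation K := (scalar_field R s).
Local Notation V := (kothe_space s a).
Local Notation nrm := (@kothe_seminorm R s a).

Lemma kothe_norm_le (u : nat -> K^o) k C :
  (forall N, \sum_(i < N) modulus (u i : K) * a i k <= C) ->
  (kothe_norm a k u <= C%:E)%E.
Proof.
move=> uC; apply: lime_le.
  apply: is_cvg_nneseries => n _ _.
  by rewrite lee_fin mulr_ge0 ?modulus_ge0 ?kothe_coef_ge0.
by apply: nearW => N; rewrite sumEFin lee_fin big_mkord.
Qed.

Lemma kothe_seminorm_le (c : V) k C :
  (forall N, \sum_(i < N) modulus (c i : K) * a i k <= C) -> nrm k c <= C.
Proof. by move=> /kothe_norm_le cC; rewrite -lee_fin kothe_seminormE. Qed.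

Lemma kothe_partial_sum_le (c : V) k N :
  \sum_(i < N) modulus (c i : K) * a i k <= nrm k c.
Proof.
rewrite -lee_fin kothe_seminormE -(big_mkord xpredT (fun i => modulus (c i : K) * a i k)).
rewrite -sumEFin; apply: nneseries_lim_ge => n _ _.
by rewrite lee_fin mulr_ge0 ?modulus_ge0 ?kothe_coef_ge0.
Qed.

Lemma kothe_summableP (u : nat -> K^o) :
  (forall k, exists C, forall N, \sum_(i < N) modulus (u i : K) * a i k <= C) ->
  u \in @kothe_summable R s a.
Proof.
move=> uC; rewrite inE /= => k; have [C /kothe_norm_le kC] := uC k.
by rewrite (le_lt_trans kC)// ltry.
Qed.

Lemma kothe_coord_le (c : V) k i : modulus (c i : K) * a i k <= nrm k c.
Proof.
apply: le_trans (kothe_partial_sum_le c k i.+1).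
rewrite big_ord_recr/= lerDr sumr_ge0// => j _.
by rewrite mulr_ge0 ?modulus_ge0 ?kothe_coef_ge0.
Qed.

Lemma kothe_seminorm_semi k : seminorm (nrm k : V -> R).
Proof. by split=> [x y|c x]; [exact: kothe_seminormD|exact: kothe_seminormZ]. Qed.

Lemma kothe_seminorm_cts k : cts_seminorm (nrm k : V -> R).
Proof.
split; first exact: kothe_seminorm_semi.
by move=> e e0; exists k, e => // x; rewrite /kothe_ball/= subr0.
Qed.

Lemma kothe_cts_le (q : V -> R) : cts_seminorm q ->
  exists k, exists2 C, 0 <= C & forall c, q c <= C * nrm k c.
Proof.
move=> [qs /(_ 1 ltr01)[k [e e0 eq]]]; exists k, e^-1; first by rewrite invr_ge0 ltW.
move=> c; apply/ler_addgt0Pr => d d0.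
have t0 : 0 < e^-1 * nrm k c + d by rewrite ltr_wpDl// mulr_ge0 ?invr_ge0 ?kothe_seminorm_ge0// ltW.
have := eq (scal s (e^-1 * nrm k c + d)^-1 *: c).
rewrite /kothe_ball/= subr0 kothe_seminormZ qs.2 modulus_scal gtr0_norm ?invr_gt0//.
rewrite !ltr_pdivrMl// mulr1 => h; apply/ltW/h.
by rewrite mulrDl mulrAC mulVf ?gt_eqF// mul1r ltrDl mulr_gt0.
Qed.

Lemma kothe_eq (c d : V) : (forall k, nrm k (c - d) = 0) -> c = d.
Proof.
move=> cd; apply/val_inj/funext => i; apply/eqP; rewrite -subr_eq0; apply/eqP.
apply: (@modulus_eq0 R s); have [k ak] := kothe_coef_pos a i.
have := kothe_coord_le (c - d) k i; rewrite cd => h.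
apply/eqP; rewrite eq_le modulus_ge0 andbT.
by move: h; rewrite pmulr_lle0.
Qed.

Lemma small_sum (b : nat -> nat -> R) N e : 0 < e ->
  (forall i e, 0 < e -> exists M, forall m, (M <= m)%N -> b m i < e) ->
  exists M, forall m, (M <= m)%N -> \sum_(i < N) b m i < e.
Proof.
move=> + bM; elim: N e => [|N IH] e e0; first by exists 0%N => m _; rewrite big_ord0.
have e2 : 0 < e / 2 by rewrite divr_gt0.
have [M1 h1] := IH _ e2; have [M2 h2] := bM N _ e2.
exists (maxn M1 M2) => m; rewrite geq_max big_ord_recr/= => /andP[/h1 + /h2].
by lra.
Qed.

(** Each coordinate carries a positive weight in some column, so coordinatewise limits exist. The
    Cauchy bound passes to them on partial sums, with a threshold independent of their length. *)
Lemma kothe_complete (c : nat -> V) :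
  (forall k e, 0 < e -> exists N, forall m n, (N <= m)%N -> (N <= n)%N ->
     nrm k (c m - c n) < e) ->
  exists d, forall k e, 0 < e -> exists N, forall n, (N <= n)%N ->
     nrm k (c n - d) < e.
Proof.
move=> cC.
have /choice[d dP] i : exists l : K, forall e : R, 0 < e -> exists N, forall n,
    (N <= n)%N -> modulus ((c n i : K) - l) < e.
  apply: modulus_complete => e e0; have [k ak] := kothe_coef_pos a i.
  have [N NP] := cC k _ (mulr_gt0 e0 ak); exists N => m n mN nN.
  rewrite -(ltr_pM2r ak) (le_lt_trans _ (NP m n mN nN))//.
  exact: (kothe_coord_le (c m - c n)).
have dsmall k e : 0 < e -> exists N0, forall n, (N0 <= n)%N ->
    forall N, \sum_(i < N) modulus ((c n i : K) - d i) * a i k <= e.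
  move=> /(cC k)[N0 N0P]; exists N0 => n nN0 N.
  apply/ler_addgt0Pr => r r0.
  have [|M MP] := @small_sum (fun m i => modulus ((c m i : K) - d i) * a i k) N r r0.
    move=> i t t0; have [M MP] := dP i _ (divr_gt0 t0 (ltr_pwDr ltr01 (kothe_coef_ge0 a i k))).
    exists M => m /MP; rewrite ltr_pdivlMr ?ltr_pwDr ?kothe_coef_ge0// => /(le_lt_trans _); apply.
    by rewrite ler_wpM2l ?modulus_ge0// lerDl.
  have mN0 : (N0 <= maxn N0 M)%N by rewrite leq_maxl.
  have := MP (maxn N0 M) (leq_maxr _ _); set m := maxn N0 M => mr.
  have := N0P n m nN0 mN0; have := kothe_partial_sum_le (c n - c m) k N => h1 h2.
  apply: (@le_trans _ _ (\sum_(i < N) (modulus ((c n - c m) i : K) * a i k +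
      modulus ((c m i : K) - d i) * a i k))).
    apply: ler_sum => i _; rewrite -mulrDl ler_wpM2r ?kothe_coef_ge0//.
    by rewrite -(subrK (c m i : K) (c n i)) -addrA modulusD.
  by rewrite big_split/=; lra.
have dsum : (d : nat -> K^o) \in @kothe_summable R s a.
  apply: kothe_summableP => k; have [n nP] := dsmall k 1 ltr01.
  exists (nrm k (c n) + 1) => N.
  apply: le_trans (lerD (kothe_partial_sum_le (c n) k N) (nP n (leqnn _) N)).
  rewrite -big_split/=; apply: ler_sum => i _.
  rewrite -mulrDl ler_wpM2r ?kothe_coef_ge0//.
  rewrite modulusBC addrC -{1}(subrK (c n i : K) (d i)); exact: modulusD.
exists (KotheSpace dsum) => k e e0.
have e2 : 0 < e / 2 by rewrite divr_gt0.
have [N NP] := dsmall k _ e2; exists N => n /NP h.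
rewrite (@le_lt_trans _ _ (e / 2))//; last by lra.
exact: kothe_seminorm_le.
Qed.

(** Some partial sum comes within e of the norm, so everything after it has total weight below e. *)
Lemma kothe_tail (c : V) k e : 0 < e -> exists N, forall n m, (N <= n)%N ->
  \sum_(n <= i < m) modulus (c i : K) * a i k < e.
Proof.
move=> e0; pose b i := modulus (c i : K) * a i k.
have b0 i : 0 <= b i by rewrite mulr_ge0 ?modulus_ge0 ?kothe_coef_ge0.
have [N NP] : exists N, nrm k c - e < \sum_(i < N) b i.
  apply: contrapT => nN.
  suff : nrm k c <= nrm k c - e by rewrite lerDl oppr_ge0 leNgt e0.
  apply: kothe_seminorm_le => N; rewrite leNgt; apply/negP => Nc.
  by apply: nN; exists N.
exists N => n m Nn; have [mn|/ltnW nm] := leqP m n; first by rewrite big_geq.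
have := kothe_partial_sum_le c k m; move: NP; rewrite -!(big_mkord xpredT b).
rewrite (@big_cat_nat _ _ _ n 0 m)//= (@big_cat_nat _ _ _ N 0 n)//= -/(b _).
suff : 0 <= \sum_(N <= i < n) b i by rewrite -/b; lra.
by rewrite sumr_ge0.
Qed.

Definition delta_seq (i j : nat) : K^o := (j == i)%:R.

Lemma delta_seq_sum (f : nat -> R) i N :
  \sum_(j < N) modulus (delta_seq i j : K) * f j = if (i < N)%N then f i else 0.
Proof.
elim: N => [|N IH]; first by rewrite big_ord0.
rewrite big_ord_recr/= IH /delta_seq ltnS; have [->|Ni] := eqVneq N i.
  by rewrite ltnn leqnn modulus1 mul1r add0r.
by rewrite modulus0 mul0r addr0 ltn_neqAle eq_sym Ni.
Qed.

Lemma delta_seq_le i k N : \sum_(j < N) modulus (delta_seq i j : K) * a j k <= a i k.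
Proof.
rewrite (delta_seq_sum (fun j => a j k)).
by case: ifP => // _; rewrite kothe_coef_ge0.
Qed.

Lemma delta_summable i : delta_seq i \in @kothe_summable R s a.
Proof. by apply: kothe_summableP => k; exists (a i k); exact: delta_seq_le. Qed.

Definition kothe_delta i : V := KotheSpace (delta_summable i).

Lemma kothe_seminorm_delta k i : nrm k (kothe_delta i) <= a i k.
Proof. by apply: kothe_seminorm_le => N; exact: delta_seq_le. Qed.

Lemma kothe_delta_sum (c : nat -> K) n i :
  (\sum_(j < n) c j *: kothe_delta j) i = if (i < n)%N then c i else 0.
Proof.
elim: n => [|n IH]; first by rewrite big_ord0.
rewrite big_ord_recr.
transitivity ((if (i < n)%N then c i else 0) + c n * (i == n)%:R); first by rewrite -IH.
rewrite [(i < n.+1)%N]ltnS; have [->|ni] := eqVneq i n.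
  by rewrite ltnn leqnn add0r mulr1.
by rewrite mulr0 addr0 [(i < n)%N]ltn_neqAle ni.
Qed.

Lemma kothe_expansion (c : V) k e : 0 < e -> exists N, forall n, (N <= n)%N ->
  nrm k (\sum_(j < n) (c j : K) *: kothe_delta j - c) <= e.
Proof.
move=> /(kothe_tail c k)[N NP]; exists N => n Nn; apply: kothe_seminorm_le => M.
set d := _ - c.
have dE i : modulus (d i : K) = if (i < n)%N then 0 else modulus (c i : K).
  have -> : (d i : K) = (if (i < n)%N then (c i : K) else 0) - c i.
    by rewrite -(kothe_delta_sum (fun j => c j : K)).
  by case: ifP => _; rewrite ?subrr ?modulus0// sub0r modulusN.
have [Mn|/ltnW nM] := leqP M n.
  rewrite big1 ?(le_trans _ (ltW (NP n n Nn))) ?big_geq// => i _.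
  by rewrite dE (leq_trans (ltn_ord i) Mn) mul0r.
rewrite -(big_mkord xpredT (fun i => modulus (d i : K) * a i k)).
rewrite (@big_cat_nat _ _ _ n 0 M)//= big_nat big1 ?add0r; last first.
  by move=> i /andP[_ ni]; rewrite dE ni mul0r.
rewrite (le_trans _ (ltW (NP n M Nn)))// !big_nat ler_sum// => i /andP[ni _].
by rewrite dE ltnNge ni.
Qed.

End kothe_theory.

(** * Linear homeomorphisms through seminorm estimates *)

Section isomorphisms.
Context (R : realType) (s : scalar_kind).
Local Notation K := (scalar_field R s).

Lemma within_continuous_seminorm (E F : tvsType K) (A : set E) (g : E -> F) :
  (forall q, cts_seminorm q -> exists2 p, cts_seminorm p &
     forall x y, A x -> A y -> q (g x - g y) <= p (x - y)) ->
  {within A, continuous g}.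
Proof.
move=> gP; apply/subspace_continuousP => x Ax B /nbhs_seminormP[q /gP[p pc qp] qB].
have := cts_seminorm_nbhs x pc ltr01; apply: filterS => y yx Ay.
by apply: qB; rewrite (le_lt_trans (qp _ _ Ay Ax)).
Qed.

Lemma isomorphism_on_seminorm (E F : tvsType K) (A : set E) (f : E -> F) :
  (forall (c : K) x y, A x -> A y -> f (c *: x + y) = c *: f x + f y) ->
  (forall x y, A x -> A y -> f x = f y -> x = y) ->
  (forall q, cts_seminorm q -> exists2 p, cts_seminorm p &
     forall x y, A x -> A y -> q (f x - f y) <= p (x - y)) ->
  (forall p, cts_seminorm p -> exists2 q, cts_seminorm q &
     forall x y, A x -> A y -> p (x - y) <= q (f x - f y)) ->
  isomorphism_on A (f @` A) f.
Proof.
move=> flin finj fc gc.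
(* The inverse picks the unique preimage in [A]; the default 0 occurs only outside the image, where
   nothing is claimed. *)
have fgK x : A x -> xget 0 [set z | A z /\ f z = f x] = x.
  move=> Ax; case: xgetP => [z _ [Az]|/(_ x)[]//]; exact: finj.
split=> //.
- split; [by move=> x Ax; exists x| |by []].
  by move=> x y /set_mem Ax /set_mem Ay; exact: finj.
- exact: within_continuous_seminorm.
exists (fun y => xget 0 [set z | A z /\ f z = y]); split=> //.
apply: within_continuous_seminorm => p /gc[q qc pq]; exists q => //.
by move=> _ _ [x Ax <-] [y Ay <-]; rewrite !fgK//; exact: pq.
Qed.

Lemma seminorm_dominate (V : lmodType K) (p q : V -> R) : seminorm p ->
  seminorm q -> (forall z, p z < 1 -> q z < 1) -> forall z, q z <= p z.
Proof.
move=> ps qs pq z; apply/ler_addgt0Pr => d d0.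
have t0 : 0 < p z + d by rewrite ltr_wpDl// (seminorm_ge0 ps).
have := pq (scal s (p z + d)^-1 *: z).
rewrite ps.2 qs.2 modulus_scal gtr0_norm ?invr_gt0//.
by rewrite !ltr_pdivrMl// mulr1 ltrDl => /(_ d0)/ltW.
Qed.

Lemma frechet_seq (E : tvsType K) (u : nat -> E) : frechet E ->
  (forall q, cts_seminorm q -> forall e, 0 < e -> exists N, forall m n,
     (N <= m)%N -> (N <= n)%N -> q (u m - u n) < e) ->
  exists l, forall q, cts_seminorm q -> forall e, 0 < e ->
    exists N, forall n, (N <= n)%N -> q (u n - l) < e.
Proof.
move=> [_ _ cE] uC; have [|l ul] := cE (u @ \oo) _.
  move=> U /gauge_exists[q qc qU]; have [N NP] := uC q qc 1 ltr01.
  exists (u @` [set n | (N <= n)%N]); first by exists N => // n nN; exists n.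
  by move=> _ _ [m mN <-] [n nN <-]; apply/qU/NP.
exists l => q qc e e0.
have [N _ NP] := ul _ (cts_seminorm_nbhs l qc e0).
by exists N => n nN; exact: NP.
Qed.

End isomorphisms.

(** * The closed subspace of sums of the basic sequence *)

Section embedding.
Context (R : realType) (s : scalar_kind).
Local Notation K := (scalar_field R s).
Context (E F : tvsType K) (frechetE : frechet E).
Context (T : {linear E -> F}) (contT : continuous T).
Context (p : nat -> E -> R) (x : nat -> E).
Hypotheses (pc : forall k, cts_seminorm (p k))
  (pmono : forall k l z, (k <= l)%N -> p k z <= p l z)
  (pbase : forall U, nbhs 0 U -> exists k, forall z, p k z < 1 -> U z)
  (estimate : forall k, exists2 q : F -> R, cts_seminorm q &
     forall (c : nat -> K) N, \sum_(i < N) modulus (c i) * p k (x i) <=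
       q (T (\sum_(i < N) c i *: x i))).
Context (a : kothe_matrix R) (ap : forall i k, a i k = p k (x i)).
Local Notation V := (kothe_space s a).
Local Notation nrm := (@kothe_seminorm R s a).

Let Tlin : linear T. Proof. by move=> c u v; rewrite linearP. Qed.

Lemma base_le q : cts_seminorm q -> exists k, forall z, q z <= p k z.
Proof.
move=> [qs /(_ 1 ltr01)/pbase[k kq]]; exists k.
exact: seminorm_dominate (pc k).1 qs kq.
Qed.

Lemma base_seminorm_eq (y z : E) : (forall k, p k (y - z) = 0) -> y = z.
Proof.
move=> yz; apply/eqP; rewrite -subr_eq0; apply/eqP.
have [hE _ _] := frechetE; apply: hausdorff_seminorm => // q qc.
have [k qk] := base_le qc; apply/eqP; rewrite eq_le (seminorm_ge0 qc.1) andbT.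
by rewrite -(yz k).
Qed.

Lemma partial_sum_le k (c : V) N :
  p k (\sum_(i < N) (c i : K) *: x i) <= nrm k c.
Proof.
rewrite (le_trans _ (kothe_partial_sum_le c k N))//.
rewrite (le_trans (seminorm_sum (pc k).1 _ _ _))// ler_sum// => i _.
by rewrite (pc k).1.2 ap.
Qed.

Lemma partial_sum_tail k (c : V) e : 0 < e -> exists N, forall m n,
  (N <= m)%N -> (N <= n)%N ->
  p k (\sum_(i < m) (c i : K) *: x i - \sum_(i < n) (c i : K) *: x i) < e.
Proof.
move=> e0.
have [N NP] := kothe_tail c k e0.
have tail m n : (N <= m)%N -> (m <= n)%N ->
    p k (\sum_(i < m) (c i : K) *: x i - \sum_(i < n) (c i : K) *: x i) < e.
  move=> Nm mn; rewrite (seminormBC (pc k).1).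
  rewrite -!(big_mkord xpredT (fun i => (c i : K) *: x i)).
  rewrite (@big_cat_nat _ _ _ m 0 n)//= addrAC subrr add0r.
  rewrite (le_lt_trans (seminorm_sum (pc k).1 _ _ _))//.
  rewrite (le_lt_trans _ (NP m n Nm))// ler_sum// => i _.
  by rewrite (pc k).1.2 ap.
exists N => m n mN nN; have [mn|/ltnW nm] := leqP m n; first exact: tail.
by rewrite (seminormBC (pc k).1) tail.
Qed.

Lemma basis_sum_exists (c : V) : exists l, forall q, cts_seminorm q ->
  forall e, 0 < e -> exists N, forall n, (N <= n)%N ->
    q (\sum_(i < n) (c i : K) *: x i - l) < e.
Proof.
apply: frechet_seq => // q /base_le[k qk] e e0.
have [N NP] := partial_sum_tail k c e0; exists N => m n mN nN.
by rewrite (le_lt_trans (qk _))// NP.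
Qed.

(** The limit is picked by choice; [basis_sum_unique], which rests on E being Hausdorff, identifies
    it in computations. *)
Definition basis_sum (c : V) : E := projT1 (cid (basis_sum_exists c)).

Lemma basis_sumP (c : V) q : cts_seminorm q ->
  forall e, 0 < e -> exists N, forall n, (N <= n)%N ->
    q (\sum_(i < n) (c i : K) *: x i - basis_sum c) < e.
Proof. by rewrite /basis_sum; case: cid => l; apply. Qed.

Lemma basis_sum_unique (c : V) l :
  (forall k e, 0 < e -> exists n, forall m, (n <= m)%N ->
     p k (\sum_(i < m) (c i : K) *: x i - l) < e) ->
  basis_sum c = l.
Proof.
move=> cl; apply: base_seminorm_eq => k; apply/eqP; rewrite eq_le (seminorm_ge0 (pc k).1).
rewrite andbT; apply/ler_addgt0Pr => e e0; rewrite add0r.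
have e2 : 0 < e / 2 by rewrite divr_gt0.
have [n nP] := cl k _ e2; have [m mP] := basis_sumP c (pc k) e2.
have := nP _ (leq_maxl n m); have := mP _ (leq_maxr n m).
set S := \sum_(i < _) _.
have := seminorm_triangle (pc k).1 S (basis_sum c) l.
by rewrite (seminormBC (pc k).1 (basis_sum c) S); lra.
Qed.

Lemma basis_sum_linear : linear basis_sum.
Proof.
move=> b c d; apply: basis_sum_unique => k e e0.
have e2 : 0 < e / 2 by rewrite divr_gt0.
have b1 : 0 < modulus b + 1 by rewrite ltr_wpDl// modulus_ge0.
have [n nP] := basis_sumP c (pc k) (divr_gt0 e2 b1).
have [m mP] := basis_sumP d (pc k) e2.
exists (maxn n m) => j; rewrite geq_max => /andP[/nP hn /mP hm].
rewrite (_ : _ - _ = b *: (\sum_(i < j) (c i : K) *: x i - basis_sum c) +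
   (\sum_(i < j) (d i : K) *: x i - basis_sum d)); last first.
  rewrite scalerBr opprD addrACA scaler_sumr -big_split/=; congr (_ + _).
  by apply: eq_bigr => i _; rewrite scalerA -scalerDl.
rewrite (le_lt_trans ((pc k).1.1 _ _))// [ltRHS]splitr ler_ltD//.
rewrite (pc k).1.2; move: hn; rewrite ltr_pdivlMr// => /ltW; apply: le_trans.
by rewrite mulrC ler_wpM2l ?lerDl// (seminorm_ge0 (pc k).1).
Qed.

Lemma basis_sum_le k (c : V) : p k (basis_sum c) <= nrm k c.
Proof.
apply/ler_addgt0Pr => e e0; have [n /(_ n (leqnn n)) nP] := basis_sumP c (pc k) e0.
have := partial_sum_le k c n.
have := seminorm_leD (pc k).1 (basis_sum c) (\sum_(i < n) (c i : K) *: x i - basis_sum c).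
by rewrite subrKC; lra.
Qed.

(** The estimate on finite sums passes to the limit because q o T is continuous. Summing up to the
    maximum of n and N makes the sum both close to the limit and at least N terms long. *)
Lemma basis_sum_ge k : exists2 q, cts_seminorm q &
  forall c, nrm k c <= q (T (basis_sum c)).
Proof.
have [q qc qP] := estimate k; exists q => // c; apply: kothe_seminorm_le => N.
apply/ler_addgt0Pr => e e0.
have [n nP] := basis_sumP c (cts_seminorm_comp Tlin contT qc) e0.
have := nP _ (leq_maxl n N); set S := \sum_(i < _) _ => Se.
have := qP (fun i => c i : K) (maxn n N); rewrite -/S => h.
have h2 := seminorm_leD qc.1 (T S) (T (basis_sum c) - T S).
rewrite subrKC (seminormBC qc.1 (T (basis_sum c))) -linearB in h2.
have : \sum_(i < N) modulus (c i : K) * a i k <=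
    \sum_(i < maxn n N) modulus (c i : K) * p k (x i).
  rewrite (eq_bigr (fun i : 'I_N => modulus (c i : K) * p k (x i))); last first.
    by move=> i _; rewrite ap.
  rewrite -!(big_mkord xpredT (fun i => modulus (c i : K) * p k (x i))).
  rewrite (@big_cat_nat _ _ _ N 0 (maxn n N)) ?leq_maxr//= lerDl sumr_ge0// => i _.
  by rewrite mulr_ge0 ?modulus_ge0// (seminorm_ge0 (pc k).1).
by lra.
Qed.

Lemma basis_sum_inj (c d : V) : T (basis_sum c) = T (basis_sum d) -> c = d.
Proof.
move=> cd; apply: kothe_eq => k; have [q qc qP] := basis_sum_ge k.
apply/eqP; rewrite eq_le kothe_seminorm_ge0 andbT (le_trans (qP _))//.
rewrite (linear_funB _ _ basis_sum_linear) linearB/= cd subrr.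
by rewrite (seminorm0 qc.1).
Qed.

Lemma basis_sum_basis i : range basis_sum (x i).
Proof.
exists (kothe_delta s a i) => //; apply: basis_sum_unique => k e e0.
exists i.+1 => m im; rewrite (_ : \sum_(j < m) _ = x i).
  by rewrite subrr (seminorm0 (pc k).1).
rewrite (bigD1 (Ordinal im))//= /delta_seq eqxx scale1r big1 ?addr0// => j ji.
by rewrite (negbTE (ji : (j : nat) != i)) scale0r.
Qed.

(** A point of the closure is approached by images of some c_n. By [basis_sum_ge] the c_n form a
    Cauchy sequence in the Koethe space, and their limit there is a preimage of the point. *)
Lemma basis_sum_closed : closed (range basis_sum).
Proof.
move=> y yM.
have inv0 n : 0 < n.+1%:R^-1 :> R by rewrite invr_gt0.
have /choice[c cP] n : exists c, p n (basis_sum c - y) < n.+1%:R^-1.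
  have [_ [[c _ <-] cy]] := yM _ (cts_seminorm_nbhs y (pc n) (inv0 n)).
  by exists c.
have csmall k e : 0 < e -> exists N, forall n, (N <= n)%N ->
    p k (basis_sum (c n) - y) < e.
  move=> e0; have [N NP] := archi_nat e^-1; exists (maxn N k) => n.
  rewrite geq_max => /andP[Nn kn]; rewrite (le_lt_trans (pmono _ kn))//.
  rewrite (lt_trans (cP n))// -[e]invrK ltf_pV2 ?posrE ?invr_gt0//.
  by rewrite (lt_le_trans NP)// ler_nat ltnW.
have [|d dP] := @kothe_complete R s a c.
  move=> k e e0; have [q qc qP] := basis_sum_ge k.
  have [l lP] := base_le (cts_seminorm_comp Tlin contT qc).
  have e2 : 0 < e / 2 by rewrite divr_gt0.
  have [N NP] := csmall l _ e2; exists N => m n /NP hm /NP hn.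
  rewrite (le_lt_trans (qP _))// (linear_funB _ _ basis_sum_linear).
  rewrite (le_lt_trans (lP _))//.
  have := seminorm_triangle (pc l).1 y (basis_sum (c m)) (basis_sum (c n)).
  by rewrite (seminormBC (pc l).1 y (basis_sum (c n))); lra.
exists d => //; apply: base_seminorm_eq => k; apply/eqP.
rewrite eq_le (seminorm_ge0 (pc k).1) andbT; apply/ler_addgt0Pr => e e0.
rewrite add0r; have e2 : 0 < e / 2 by rewrite divr_gt0.
have [N NP] := csmall k _ e2; have [M MP] := dP k _ e2.
have := NP _ (leq_maxl N M); have := MP _ (leq_maxr N M).
set z := c _ => h1 h2.
have := basis_sum_le k (z - d); rewrite (linear_funB _ _ basis_sum_linear).
have := seminorm_triangle (pc k).1 (basis_sum z) (basis_sum d) y.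
by rewrite (seminormBC (pc k).1 (basis_sum d) (basis_sum z)); lra.
Qed.

(** Among n + 1 of the x_i, all in the span of n vectors, a nontrivial relation would hold; the
    estimate at k = 0 makes its weighted coefficient sum vanish, against p_0(x_i) > 0. *)
Lemma basis_sum_infinite : (forall i, 0 < p 0 (x i)) ->
  ~ finite_dimensional (range basis_sum).
Proof.
move=> x0 [n [v [_ vP]]].
have /choice[C CP] j : exists c : 'I_n -> K, x j = \sum_(i < n) c i *: v i.
  by apply: vP; exact: basis_sum_basis.
pose A : 'M[K]_(n.+1, n) := \matrix_(j, i) C j i.
have /rowV0Pn[u /sub_kermxP uA u0] : kermx A != 0.
  by rewrite kermx_eq0 /row_free neq_ltn ltnS rank_leq_col.
move: u0; rewrite -subr_eq0 subr0 => /eqP; apply.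
(* [estimate] takes sequences, so the row u is extended by 0. *)
pose w (j : nat) : K := if insub j is Some i then u 0 (i : 'I_n.+1) else 0.
have wE (j : 'I_n.+1) : w j = u 0 j by rewrite /w valK.
have w0 : \sum_(j < n.+1) w j *: x j = 0.
  transitivity (\sum_(j < n.+1) \sum_(i < n) (w j * C j i) *: v i).
    by apply: eq_bigr => j _; rewrite CP scaler_sumr; apply: eq_bigr => i _; rewrite scalerA.
  rewrite exchange_big big1//= => i _; rewrite -scaler_suml.
  have := congr1 (fun M : 'rV[K]_n => M 0 i) uA; rewrite !mxE => uA0.
  rewrite (eq_bigr (fun j => u 0 j * A j i)) ?uA0 ?scale0r// => j _.
  by rewrite wE mxE.
have [q qc /(_ w n.+1)] := estimate 0.
rewrite w0 linear0 (seminorm0 qc.1) => wsum.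
apply/rowP => j; rewrite mxE -wE; apply: (@modulus_eq0 R s).
apply/eqP; rewrite eq_le modulus_ge0 andbT -(pmulr_lle0 _ (x0 j)).
apply: le_trans wsum; rewrite (bigD1 j)//= lerDl sumr_ge0// => i _.
by rewrite mulr_ge0 ?modulus_ge0// ltW.
Qed.

End embedding.

(** * Nuclearity *)

Section nuclearity.
Context (R : realType) (s : scalar_kind).
Local Notation K := (scalar_field R s).

Definition rnorm (B : normedModType K) (b : B) : R := modulus (`|b| : K).

Lemma rnormE (B : normedModType K) (b : B) : `|b| = scal s (rnorm b).
Proof. exact/ge0_scal/normr_ge0. Qed.

Lemma rnorm_seminorm (B : normedModType K) : seminorm (@rnorm B).
Proof.
split=> [x y|c x]; last by rewrite /rnorm normrZ modulusM normE modulus_scal ger0_norm ?modulus_ge0.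
by have := ler_normD x y; rewrite !rnormE -scalD scal_le.
Qed.

Lemma rnorm_cts (B : completeNormedModType K) : cts_seminorm (@rnorm B).
Proof.
split; first exact: rnorm_seminorm.
move=> e e0; apply/nbhs_ballP; exists (scal s e); first by rewrite /= scal_gt0.
by move=> b; rewrite -ball_normE /= sub0r normrN rnormE scal_lt.
Qed.

Lemma cvg_rnormP (B : normedModType K) (u : nat -> B) l : u @ \oo --> l <->
  forall e, 0 < e -> exists N, forall n, (N <= n)%N -> rnorm (u n - l) < e.
Proof.
split=> [/cvgrPdist_lt ul e e0|ul].
  have [|N _ NP] := ul (scal s e); first by rewrite scal_gt0.
  by exists N => n nN; rewrite -(scal_lt s) -rnormE distrC; exact: NP.
apply/cvgrPdist_lt => e e0; have eE := ge0_scal (ltW e0).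
have [|N NP] := ul (modulus e); first by rewrite -(scal_gt0 s) -eE.
by exists N => // n nN; rewrite distrC rnormE eE scal_lt; exact: NP.
Qed.

Lemma banach_seq (B : completeNormedModType K) (u : nat -> B) :
  (forall e, 0 < e -> exists N, forall m n, (N <= m)%N -> (N <= n)%N ->
     rnorm (u m - u n) < e) -> cvgn u.
Proof.
move=> uC; apply/cauchy_cvgP/cauchy_ballP => e e0; have eE := ge0_scal (ltW e0).
have [|N NP] := uC (modulus e); first by rewrite -(scal_gt0 s) -eE.
pose A : set B := u @` [set n | (N <= n)%N].
exists (A, A); first by split; exists N => // n nN; exists n.
move=> [_ _] /= [[m mN <-] [n nN <-]]; rewrite -ball_normE /=.
by rewrite rnormE eE scal_lt; exact: NP.
Qed.

(* The extension [g] is characterised by [|f x - g b| <= M |i x - b|]. *)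
Lemma dense_extend (V : lmodType K) (B : completeNormedModType K)
    (i : {linear V -> B}) (f : V -> K^o) (M : R) :
  dense (range i) -> linear f -> 0 <= M ->
  (forall x, modulus (f x : K) <= M * rnorm (i x)) ->
  exists g : B -> K^o, [/\ linear g, forall x, g (i x) = f x &
    forall b, modulus (g b : K) <= M * rnorm b].
Proof.
move=> idense flin M0 fM; have rs := rnorm_seminorm B.
have fB x y : modulus ((f x : K) - f y) <= M * rnorm (i x - i y).
  by rewrite -linearB -(linear_funB x y flin).
have approx b e : 0 < e -> exists x, rnorm (i x - b) < e.
  move=> e0; have e0' : 0 < scal s e by rewrite scal_gt0.
  have [||y [xb [x _ ixy]]] := idense (ball b (scal s e)).
  - by exists b; exact: ballxx.
  - exact: ball_open.
  by exists x; move: xb; rewrite -ixy -ball_normE /= distrC rnormE scal_lt.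
have /choice[g gP] b : exists l : K^o, forall x,
    modulus ((f x : K) - l) <= M * rnorm (i x - b).
  have /choice[v vP] n : exists x, rnorm (i x - b) < n.+1%:R^-1.
    by apply: approx; rewrite invr_gt0.
  have small e : 0 < e -> exists N, forall n, (N <= n)%N -> M * rnorm (i (v n) - b) < e.
    move=> e0; have [N NP] := archi_nat (M / e); exists N => n nN.
    rewrite (le_lt_trans (ler_wpM2l M0 (ltW (vP n))))//.
    rewrite ltr_pdivrMr// -ltr_pdivrMl// mulrC (lt_le_trans NP)//.
    by rewrite ler_nat ltnW.
  have [|l lP] := @modulus_complete R s (fun n => f (v n)).
    move=> e e0; have e2 : 0 < e / 2 by rewrite divr_gt0.
    have [N NP] := small _ e2; exists N => m n /NP hm /NP hn.
    rewrite (le_lt_trans (fB _ _))//.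
    have := ler_wpM2l M0 (seminorm_triangle rs b (i (v m)) (i (v n))).
    by rewrite (seminormBC rs b (i (v n))); lra.
  exists l => x; apply/ler_addgt0Pr => e e0.
  have e2 : 0 < e / 2 by rewrite divr_gt0.
  have [N1 h1] := lP _ e2; have [N2 h2] := small _ e2.
  pose n := maxn N1 N2; have := h1 n (leq_maxl _ _); have := h2 n (leq_maxr _ _).
  have := fB x (v n); have := ler_wpM2l M0 (seminorm_triangle rs b (i x) (i (v n))).
  have := modulusD ((f x : K) - f (v n)) ((f (v n) : K) - l).
  by rewrite subrKA (seminormBC rs b (i (v n))); lra.
have small0 (z : K) C : (forall e, 0 < e -> modulus z <= C * e) -> z = 0.
  move=> zC; apply: (@modulus_eq0 R s); apply/eqP; rewrite eq_le modulus_ge0 andbT.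
  apply/ler_addgt0Pr => e e0; rewrite add0r.
  have C1 : 0 < `|C| + 1 by rewrite ltr_wpDl.
  rewrite (le_trans (zC (e / (`|C| + 1)) _)) ?divr_gt0// mulrCA -{2}[e]mulr1.
  by rewrite ler_wpM2l ?ltW// ltr_pdivrMr// mul1r ltr_pwDr// ler_norm.
exists g; split.
- move=> c b b'; apply/eqP; rewrite -subr_eq0; apply/eqP.
  apply: (small0 _ (M * (modulus c + 1 + modulus c + 1))) => e e0.
  have [x xb] := approx b _ e0; have [y yb] := approx b' _ e0.
  have := gP (c *: b + b') (c *: x + y); have := gP b x; have := gP b' y.
  rewrite flin => h1 h2 h3.
  have -> : g (c *: b + b') - (c *: g b + g b') =
     - ((c *: f x + f y : K^o) - g (c *: b + b')) + c * ((f x : K) - g b) +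
     ((f y : K) - g b').
    have E (u v w z t : K) :
        u - (c * v + w) = - (c * z + t - u) + c * (z - v) + (t - w) by ring.
    exact: E.
  rewrite (le_trans (modulusD _ _))// (le_trans (lerD (modulusD _ _) (lexx _)))//.
  rewrite modulusN modulusM.
  have h4 : rnorm (i (c *: x + y) - (c *: b + b')) <= modulus c * e + e.
    rewrite linearP opprD addrACA -scalerBr (le_trans (rs.1 _ _))// rs.2.
    by rewrite lerD ?ler_wpM2l ?modulus_ge0// ltW.
  have h5 := ler_wpM2l M0 h4.
  have h6 := ler_wpM2l M0 (ltW xb); have h7 := ler_wpM2l M0 (ltW yb).
  have h8 := ler_wpM2l (modulus_ge0 c) (le_trans h2 h6).
  by lra.
- move=> x; have := gP (i x) x; rewrite subrr (seminorm0 rs) mulr0 => h.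
  apply/eqP; rewrite eq_sym -subr_eq0; apply/eqP; apply: (@modulus_eq0 R s).
  by apply/eqP; rewrite eq_le modulus_ge0 andbT.
move=> b; apply/ler_addgt0Pr => e e0.
(* |g b| <= |f x| + |f x - g b| <= M |b| + 2 M |i x - b|, and this choice keeps the last term below
   e; the 1 keeps the denominator positive. *)
have [x xb] := approx b (e / (M + M + 1)) (ltac:(by rewrite divr_gt0// ltr_wpDl// addr_ge0)).
have := gP b x; have := fM x; have := modulusD (f x : K) (- ((f x : K) - g b)).
rewrite modulusN opprB subrKC.
have := ler_wpM2l M0 (seminorm_leD rs (i x) (- b)); rewrite (seminormN rs).
have := ler_wpM2l M0 (ltW xb).
have : M * (e / (M + M + 1)) + M * (e / (M + M + 1)) <= e.
  rewrite -mulrDl mulrA ler_pdivrMr ?ltr_wpDl ?addr_ge0// mulrC.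
  by rewrite ler_wpM2l ?ltW// ltrDl.
by lra.
Qed.

End nuclearity.

(** * Nuclear Koethe spaces *)

Section kothe_nuclear.
Context (R : realType) (s : scalar_kind) (a : kothe_matrix R).
Local Notation K := (scalar_field R s).
Local Notation V := (kothe_space s a).
Local Notation nrm := (@kothe_seminorm R s a).

(** p x + p (- x) >= 0 forces nonnegative, hence real, values, so passing to the modulus loses
    nothing. *)
Lemma continuous_seminorm_real (E : tvsType K) (p : E -> K^o) :
  continuous_seminorm p ->
  cts_seminorm (fun x => modulus (p x : K)) /\
  forall x, (p x : K) = scal s (modulus (p x : K)).
Proof.
move=> [pD pZ pc].
have p0 : p 0 = 0 by rewrite -(scale0r 0) pZ normr0 mul0r.
have pN x : p (- x) = p x by rewrite -scaleN1r pZ normrN1 mul1r.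
have p_ge0 x : 0 <= (p x : K).
  have := pD x (- x); rewrite subrr p0 pN -mulr2n.
  by rewrite pmulrn_lge0.
have pE x : (p x : K) = scal s (modulus (p x : K)) by exact: ge0_scal.
split=> //; split.
  split=> [x y|c x]; last by rewrite pZ modulusM normE modulus_scal ger0_norm ?modulus_ge0.
  by rewrite -(scal_le s) scalD -!pE; exact: pD.
move=> e e0; have : nbhs 0 (p @^-1` _) := pc 0 _ (nbhs_modulus (p 0) e0).
apply: filterS => x /=.
by rewrite p0 subr0.
Qed.

Lemma cts_seminorm_scalar (E : tvsType K) (q : E -> R) : cts_seminorm q ->
  continuous_seminorm (fun x => scal s (q x) : K^o).
Proof.
move=> qc; have [[qD qZ] _] := qc; have qs := qc.1; split=> [x y|c x|x A].
- by rewrite -scalD scal_le.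
- by rewrite qZ scalM normE.
move=> /nbhs_modulusP[e e0 eA].
have := cts_seminorm_nbhs x qc e0; apply: filterS => y /= yx.
apply: eA; rewrite -scalB modulus_scal (le_lt_trans _ yx)// ler_norml.
have := seminorm_leD qs y (x - y); have := seminorm_leD qs x (y - x).
rewrite !subrKC (seminormBC qs x y) => h1 h2.
by apply/andP; split; lra.
Qed.

(* The easy half of the Grothendieck-Pietsch criterion: the canonical map is
   the sum of the coordinate functionals times the unit vectors. *)
Lemma kothe_nuclear : (forall n k, 0 < a n k) ->
  (forall k, exists l, (k <= l)%N /\
     exists C, forall N, \sum_(n < N) a n k / a n l <= C) ->
  nuclear_space (V : tvsType K).
Proof.
move=> a0 aC p0 pc; have [Pc pE] := continuous_seminorm_real pc.
have [k [C C0 CP]] := kothe_cts_le Pc; have [l [kl [D DP]]] := aC k.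
have C1 : 0 < C + 1 by rewrite ltr_wpDl.
(* C + 1 in place of C keeps the factor invertible when C = 0, and q still dominates p0. *)
pose q (x : V) := (C + 1) * nrm l x.
have qc : cts_seminorm q.
  by apply: cts_seminormZ; [exact: ltW|exact: kothe_seminorm_cts].
exists (fun x => scal s (q x)); split.
- exact: cts_seminorm_scalar.
- move=> x; rewrite [p0 x]pE scal_le (le_trans (CP x))//.
  rewrite ler_pM ?kothe_seminorm_ge0 ?lerDl//; exact: kothe_seminorm_mono.
move=> Eq Ep iq ip [iqE iqD] [ipE ipD].
have rq x : rnorm (iq x) = q x.
  by rewrite /rnorm iqE modulus_scal ger0_norm// (seminorm_ge0 qc.1).
have rp x : rnorm (ip x) <= C * nrm k x.
  by rewrite /rnorm ipE; exact: CP.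
(* A bound for the norm of the j-th coordinate functional with respect to q: |x_j| a_{j,l} <=
   ||x||_l = q x / (C + 1). *)
pose M j := ((C + 1) * a j l)^-1.
have M0 j : 0 <= M j by rewrite invr_ge0 ltW// mulr_gt0.
have /choice[g gP] j : exists g : Eq -> K^o, [/\ linear g,
    forall x, g (iq x) = (x : V) j & forall b, modulus (g b : K) <= M j * rnorm b].
  apply: (@dense_extend R s V Eq iq (fun x : V => x j) (M j)) => //.
  move=> x; rewrite rq /q /M ler_pdivlMl ?mulr_gt0// -mulrA ler_wpM2l ?(ltW C1)// mulrC.
  exact: kothe_coord_le.
pose y j := ip (kothe_delta s a j).
(* The factors C + 1 cancel, leaving the summable ratio of the hypothesis. *)
have yM j : M j * rnorm (y j) <= a j k / a j l.
  have yj : rnorm (y j) <= (C + 1) * a j k.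
    rewrite (le_trans (rp _))// ler_pM ?kothe_seminorm_ge0 ?lerDl//.
    exact: kothe_seminorm_delta.
  rewrite (le_trans (ler_wpM2l (M0 j) yj))// /M invfM mulrACA mulVf ?gt_eqF//.
  by rewrite mul1r mulrC.
pose w j := M j * rnorm (y j).
have w0 j : 0 <= w j by rewrite mulr_ge0 ?modulus_ge0.
have wC e : 0 < e -> exists N, forall m n, (N <= m)%N -> (m <= n)%N ->
    \sum_(m <= j < n) w j < e.
  move=> e0; pose A := [set \sum_(j < N) w j | N in [set: nat]].
  have As : has_sup A.
    split; first by exists (\sum_(j < 0) w j), 0%N.
    exists D => _ [N _ <-]; rewrite (le_trans _ (DP N))//.
    by apply: ler_sum => j _; exact: yM.
  have [_ [N _ <-] NP] := sup_adherent e0 As; exists N => m n Nm mn.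
  have : \sum_(j < n) w j <= sup A by apply: (ub_le_sup As.2); exists n.
  move: NP; rewrite -!(big_mkord xpredT w).
  rewrite (@big_cat_nat _ _ _ N 0 n) ?(leq_trans Nm)//= (@big_cat_nat _ _ _ m N n)//=.
  have : 0 <= \sum_(N <= j < m) w j by rewrite sumr_ge0.
  by lra.
pose S (b : Eq) := series (fun j => g j b *: y j).
have SC b : cvgn (S b).
  apply: banach_seq => e e0.
  have b1 : 0 < rnorm b + 1 by rewrite ltr_wpDl// modulus_ge0.
  have [N NP] := wC _ (divr_gt0 e0 b1).
  have SN m n : (N <= m)%N -> (m <= n)%N -> rnorm (S b n - S b m) < e.
    move=> Nm mn; rewrite /S /series /= (@big_cat_nat _ _ _ m 0 n)//= addrAC subrr add0r.
    rewrite (le_lt_trans (seminorm_sum (rnorm_seminorm Ep) _ _ _))//.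
    apply: (@le_lt_trans _ _ (rnorm b * \sum_(m <= j < n) w j)).
      rewrite mulr_sumr ler_sum// => j _; rewrite (rnorm_seminorm Ep).2 /w mulrA.
      rewrite ler_wpM2r ?modulus_ge0// mulrC; by have [_ _ ->] := gP j.
    have := NP m n Nm mn; rewrite ltr_pdivlMr// mulrC; apply: le_lt_trans.
    by rewrite ler_wpM2r ?sumr_ge0// lerDl.
  exists N => m n mN nN; have [mn|/ltnW nm] := leqP n m; first exact: SN.
  by rewrite (seminormBC (rnorm_seminorm Ep)) SN.
pose A b := lim (S b @ \oo).
have AP b : S b @ \oo --> A b by exact: SC.
have Alin : linear A.
  move=> c b b'; apply: (norm_cvg_unique (AP _)).
  have -> : S (c *: b + b') = (fun n => c *: S b n + S b' n).
    apply/funext => n; rewrite /S /series /= scaler_sumr -big_split/=.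
    apply: eq_bigr => j _; have [-> _ _] := gP j.
    by rewrite scalerDl scalerA.
  by apply: cvgD => //; exact: cvgZl_tmp.
pose Al : {linear Eq -> Ep} := HB.pack_for {linear Eq -> Ep} A
  (GRing.isLinear.Build K Eq Ep _ A Alin).
exists Al; split.
  exists g, (fun j => scal s (M j)), y; split.
  - move=> j; have [gl _ gM] := gP j.
    apply: (dual_le gl _ gM); apply: cts_seminormZ => //; exact: rnorm_cts.
  - move=> j; split; first by rewrite scal_ge0.
    move=> b; have [_ _ /(_ b)] := gP j.
    by rewrite normE rnormE -scalM scal_le.
  - have rK (z : K^o) : rnorm z = modulus (z : K).
      by rewrite /rnorm normE modulus_scal ger0_norm ?modulus_ge0.
    pose u := series (fun j => scal s (M j) * `|y j| : K^o).
    have uE m n : (m <= n)%N -> (u n : K) - u m = scal s (\sum_(m <= j < n) w j).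
      move=> mn; rewrite /u /series /= (@big_cat_nat _ _ _ m 0 n)//= addrAC subrr add0r.
      rewrite (big_morph (scal s) (@scalD R s) (scal0 R s)).
      by apply: eq_bigr => j _; rewrite rnormE -scalM.
    have [|L LP] := @modulus_complete R s u.
      move=> e /wC[N NP]; exists N.
      have uN m n : (N <= m)%N -> (m <= n)%N -> modulus ((u n : K) - u m) < e.
        move=> Nm mn; rewrite (uE _ _ mn) modulus_scal ger0_norm ?sumr_ge0//.
        exact: NP.
      move=> m n mN nN; have [mn|/ltnW nm] := leqP n m; first exact: uN.
      by rewrite modulusBC uN.
    apply/cvg_ex; exists L; apply/cvg_rnormP => e /LP[N NP].
    by exists N => n /NP; rewrite rK.
  - by move=> b; exact: AP.
(* On the range of [iq] the partial sums are the images under [ip] of the truncations of x, which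
   converge by [kothe_expansion]. *)
move=> x; apply: (norm_cvg_unique (AP _)).
apply/cvg_rnormP => e e0.
have [N NP] := kothe_expansion x k (divr_gt0 e0 C1); exists N => n /NP.
have -> : S (iq x) n = ip (\sum_(j < n) (x j : K) *: kothe_delta s a j).
  rewrite /S /series /= big_mkord linear_sum; apply: eq_bigr => j _.
  by rewrite linearZ/=; have [_ -> _] := gP j.
rewrite -linearB => h; rewrite (le_lt_trans (rp _))//.
rewrite (le_lt_trans (ler_wpM2l C0 h))// mulrCA -{2}[e]mulr1 ltr_pM2l//.
by rewrite ltr_pdivrMr// mul1r ltrDl.
Qed.

End kothe_nuclear.

Theorem theorem2p1 (K : realType) (s : scalar_kind)
    (E F G : tvsType (scalar_field K s))
    (frechetE : frechet E) (frechetF : frechet F) (frechetG : frechet G)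
    (yF : property_y F)
    (notomegaG : forall X : completeNormedModType (scalar_field K s),
       ~ isomorphic G (omega (scalar_field K s) * X)%type)
    (T : {linear E -> F}) (S : {linear E -> G}) (R : {linear G -> F})
    (contT : continuous T) (contS : continuous S) (contR : continuous R)
    (unboundedT : ~ bounded_operator T)
    (factT : forall x, T x = R (S x)) :
  exists M : set E,
    [/\ nuclear_kothe_subspace M,
        ~ finite_dimensional M,
        isomorphism_on M (T @` M) T &
        isomorphism_on (S @` M) (R @` (S @` M)) R].
Proof.
have [p [x [pc pmono pbase [x0 xgrow estimate]]]] :=
  unbounded_basis frechetE frechetF yF contT unboundedT.
have a_ge0 n k : 0 <= p k (x n) by exact/ltW.
have a_mono n k : p k (x n) <= p k.+1 (x n) by exact: pmono.
have a_pos n : exists k, 0 < p k (x n) by exists 0%N.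
pose a := KotheMatrix a_ge0 a_mono a_pos.
have ap i k : a i k = p k (x i) by [].
pose f := basis_sum frechetE pc pbase ap.
have flin : linear f by exact: basis_sum_linear.
have fle k c : p k (f c) <= kothe_seminorm k c by exact: basis_sum_le.
have fge k : exists2 q, cts_seminorm q & forall c, kothe_seminorm k c <= q (T (f c)).
  exact: basis_sum_ge.
have finj c d : T (f c) = T (f d) -> c = d by exact: basis_sum_inj.
have Tlin : linear T by move=> c y z; rewrite linearP.
have Slin : linear S by move=> c y z; rewrite linearP.
have Rlin : linear R by move=> c y z; rewrite linearP.
(* Lower bound for T on M: a difference is controlled by some p_k, hence by the Koethe norm of its
   coefficients, hence by a continuous seminorm of its image. *)
have Tge q : cts_seminorm q -> exists2 r, cts_seminorm r & forall y z,
    range f y -> range f z -> q (y - z) <= r (T y - T z).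
  move=> /(base_le pc pbase)[k qk]; have [r rc rP] := fge k.
  exists r => // _ _ [c _ <-] [d _ <-].
  rewrite -linearB -(linear_funB _ _ flin) (le_trans (qk _))//.
  by rewrite (le_trans (fle _ _)).
exists (range f); split.
- split.
  + split; first by exists 0 => //; exact: (linear_fun0 flin).
    by move=> c _ _ [d _ <-] [e _ <-]; exists (c *: d + e) => //; rewrite flin.
  + exact: basis_sum_closed.
  exists a; split.
    apply: kothe_nuclear => [n k|k]; first by rewrite ap.
    (* Consecutive columns suffice: a_{n,k} / a_{n,k+1} <= 6^-n <= 2^-n for n >= k. *)
    exists k.+1; split=> //.
    exists (\sum_(n < k) a n k / a n k.+1 + 2) => N.
    apply: (@sum_geometric_le _ (fun n => a n k / a n k.+1)) => n.
      by rewrite divr_ge0 ?kothe_coef_ge0.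
    move=> kn; rewrite ler_pdivrMr ?ap// exprVn ler_pdivlMl ?exprn_gt0//.
    rewrite (le_trans _ (xgrow n k kn))// ler_wpM2r// lerXn2r ?nnegrE//.
    by rewrite ler_nat.
  exists f; apply: isomorphism_on_seminorm.
  + by move=> c y z _ _; exact: flin.
  + by move=> y z _ _ yz; apply: finj; rewrite yz.
  + move=> q /(base_le pc pbase)[k qk]; exists (@kothe_seminorm K s a k).
      exact: kothe_seminorm_cts.
    by move=> c d _ _; rewrite -(linear_funB _ _ flin) (le_trans (qk _)).
  (* The inverse from M to the Koethe space is continuous because ||c||_k <= r (T (f c)) and T is
     continuous. *)
  move=> q /kothe_cts_le[k [C C0 qC]]; have [r rc rP] := fge k.
  exists (fun y => C * r (T y)).
    exact/cts_seminormZ/(cts_seminorm_comp Tlin contT rc).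
  move=> c d _ _; rewrite -(linear_funB _ _ flin) (le_trans (qC _))//.
  by rewrite ler_wpM2l.
- by apply: basis_sum_infinite => // i.
- apply: isomorphism_on_seminorm => [c y z _ _|_ _ [c _ <-] [d _ <-] /finj->//|q qc|//].
    exact: linearP.
  exists (fun y => q (T y)); first exact: cts_seminorm_comp.
  by move=> y z _ _; rewrite linearB.
apply: isomorphism_on_seminorm => [c y z _ _|_ _ [_ [c _ <-] <-] [_ [d _ <-] <-]|q qc|q qc].
- exact: linearP.
- by rewrite -!factT => /finj->.
- exists (fun y => q (R y)); first exact: cts_seminorm_comp.
  by move=> y z _ _; rewrite linearB.
(* q o S is a continuous seminorm on E, so [Tge] bounds q (S y - S z) by r (T y - T z) = r (R (S y)
   - R (S z)), which is the lower bound for R on S(M). *)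
have [r rc rP] := Tge _ (cts_seminorm_comp Slin contS qc); exists r => //.
move=> _ _ [y yM <-] [z zM <-]; rewrite -!factT -linearB.
exact: rP.
Qed.
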